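(* Let $n \ge 1$ be an integer, $N = 2n+1$, and let $H_N\mathbb{R}$ be the classical Heisenberg group of dimension $N$, with the global coordinates $(x^1,\dots,x^N)$ and the left-invariant coframe $\{\theta^1,\dots,\theta^N\}$ described in the context. Let $g_0$ be a diagonal left-invariant metric on $H_N\mathbb{R}$ and let $g(t)$, $t \in [0,\infty)$, be the (left-invariant) Ricci flow solution on $H_N\mathbb{R}$ with $g(0) = g_0$. (a) The solution $g(t)$ is diagonal and has the following asymptotic behavior as $t \to \infty$: $$ g_{ii}(t) \sim \gamma_i\, t^{1/(n+2)} \quad (i = 1,\dots,2n), \qquad g_{NN}(t) \sim \gamma_N\, t^{-n/(n+2)}, $$ where $\gamma_1,\dots,\gamma_{2n},\gamma_N$ are constants depending only on $g_0$ and $n$. (b) The solution $g(t)$ converges, after pullback of its blowdowns by diffeomorphisms, to the solution $g_\infty(t)$ corresponding to the metric $$ g_\infty = \theta^1\otimes\theta^1 + \cdots + \theta^{2n}\otimes\theta^{2n} + \frac{1}{n+2}\,\theta^N\otimes\theta^N ; $$ that is, there are diffeomorphisms $\phi_s : H_N\mathbb{R} \to H_N\mathbb{R}$, $s>0$, such that for every $t>0$ $$ \lim_{s\to\infty} \frac{1}{s}\,\phi_s^* g(st) = g_\infty(t), \qquad g_\infty(t) = t^{1/(n+2)}\big(\theta^1\otimes\theta^1 + \cdots + \theta^{2n}\otimes\theta^{2n}\big) + \frac{1}{n+2}\,t^{-n/(n+2)}\,\theta^N\otimes\theta^N , $$ where $g_\infty(1) = g_\infty$. The metric $g_\infty$ is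 a nilsoliton with respect to the diffeomorphisms $$ \eta_t(x^1,\dots,x^{2n},x^N) = \Big(t^{-\frac12\frac{n+1}{n+2}}x^1,\dots,t^{-\frac12\frac{n+1}{n+2}}x^{2n},\,t^{-\frac{n+1}{n+2}}x^N\Big), \qquad t>0, $$ i.e. $g_\infty(t) = t\,\eta_t^* g_\infty$ is a solution of Ricci flow for $t>0$.
   Context: The group $H_N\mathbb{R} \subset \mathrm{SL}_{n+2}\mathbb{R}$ consists of the real $(n+2)\times(n+2)$ matrices $\begin{pmatrix} 1 & a^T & c \\ 0 & I_n & b \\ 0 & 0 & 1\end{pmatrix}$ with $a,b\in\mathbb{R}^n$, $c\in\mathbb{R}$, under matrix multiplication, so $(a_1,b_1,c_1)(a_2,b_2,c_2) = (a_1+a_2,\,b_1+b_2,\,c_1+c_2+a_1\cdot b_2)$. The global coordinates are $(x^1,\dots,x^n) = a$, $(x^{1+n},\dots,x^{2n}) = b$, $x^N = c$. The left-invariant coframe is $$\theta^i = dx^i,\qquad \theta^{i+n} = dx^{i+n} \quad (1\le i\le n), \qquad \theta^N = dx^N - \sum_{k=1}^n x^k\,dx^{k+n},$$ which is dual to the left-invariant frame $F_i = \partial_i$, $F_{i+n} = \partial_{i+n} + x^i\partial_N$, $F_N = \partial_N$. A left-invariant metric $g = \sum_{I,J} g_{IJ}\,\theta^I\otimes\theta^J$ (constant coefficients) is diagonal if $g_{IJ}=0$ for $I\neq J$. A Ricci flow solution is a one-parameter family of metrics with $\frac{d}{dt} g = -2\,\mathrm{Rc}(g)$; solutions starting at a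 left-invariant metric are understood to be left-invariant, $g(t) = \sum g_{IJ}(t)\,\theta^I\otimes\theta^J$. For functions of $t$, $a(t)\sim b(t)$ means $\lim_{t\to\infty} a(t)/b(t) = 1$. The blowdown of $g(t)$ with parameter $s>0$ is $g_s(t) = \frac1s g(st)$. Limits of left-invariant metrics are limits of their coefficients in the coframe. A left-invariant metric $g$ on a nilpotent Lie group is a nilsoliton (with respect to diffeomorphisms $\eta_t$) if $g(t) = c(t)\,\eta_t^* g$ is a solution of Ricci flow for some function $c(t)$ and a one-parameter family of diffeomorphisms $\{\eta_t\}$; it is expanding if $c(t)=t$. *)

(* Defs.v *)
From HB Require Import structures.
From mathcomp Require Import all_boot all_order all_algebra.
From mathcomp Require Import all_classical all_reals all_analysis.

Set Implicit Arguments.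
Unset Strict Implicit.
Unset Printing Implicit Defensive.

Import Order.TTheory GRing.Theory Num.Theory.
Import numFieldNormedType.Exports.

Local Open Scope classical_set_scope.
Local Open Scope ring_scope.

(* Riemannian geometry of R^m in its global coordinates. A covariant 2-tensor
   field is given by the matrix of its components in the frame of the dx^i. *)

Definition tensor_field (R : realType) (m : nat) := 'rV[R]_m -> 'M[R]_m.

Definition partial (R : realType) (m : nat) (i : 'I_m) (f : 'rV[R]_m -> R)
  (x : 'rV[R]_m) : R := 'D_(delta_mx 0 i) f x.

Fixpoint Ck (R : realType) (m k : nat) (f : 'rV[R]_m -> R) : Prop :=
  continuous f /\
  if k is k'.+1 then
    forall i : 'I_m,
      (forall x, derivable f x (delta_mx 0 i)) /\ Ck k' (partial i f)
  else True.

Definition smooth (R : realType) (m : nat) (f : 'rV[R]_m -> R) : Prop :=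
  forall k, Ck k f.

Definition smooth_map (R : realType) (m : nat) (f : 'rV[R]_m -> 'rV[R]_m) :
  Prop := forall j, smooth (fun x => f x 0 j).

Definition diffeomorphism (R : realType) (m : nat)
    (f : 'rV[R]_m -> 'rV[R]_m) : Prop :=
  smooth_map f /\
  exists f' : 'rV[R]_m -> 'rV[R]_m,
    [/\ smooth_map f', cancel f f' & cancel f' f].

Definition inner_product (R : realType) (m : nat) (G : 'M[R]_m) : Prop :=
  G^T = G /\ forall v : 'rV[R]_m, v != 0 -> 0 < (v *m G *m v^T) 0 0.

Definition riemannian_metric (R : realType) (m : nat) (g : tensor_field R m) :
  Prop :=
  (forall i j, smooth (fun x => g x i j)) /\ forall x, inner_product (g x).

(* [jacobian] acts on row vectors: its (i, k) entry is d f^k / d x^i, so this is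
   the usual (f^* g)_ij = sum_kl d_i f^k d_j f^l g_kl(f x). *)
Definition pullback (R : realType) (m : nat) (f : 'rV[R]_m -> 'rV[R]_m)
    (g : tensor_field R m) : tensor_field R m :=
  fun x => jacobian f x *m g (f x) *m (jacobian f x)^T.

(* Gamma^k_ij of the Levi-Civita connection *)
Definition christoffel (R : realType) (m : nat) (g : tensor_field R m)
    (k i j : 'I_m) (x : 'rV[R]_m) : R :=
  2^-1 * \sum_(l < m) invmx (g x) k l *
    (partial i (fun y => g y j l) x + partial j (fun y => g y i l) x
     - partial l (fun y => g y i j) x).

(* riemann g r s p q is the component R^r_spq of the curvature tensor, with
   R(d_p, d_q) d_s = R^r_spq d_r and
   R(X, Y) = [nabla_X, nabla_Y] - nabla_[X, Y]. *)
Definition riemann (R : realType) (m : nat) (g : tensor_field R m)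
    (r s p q : 'I_m) (x : 'rV[R]_m) : R :=
  partial p (christoffel g r q s) x - partial q (christoffel g r p s) x
  + \sum_(l < m) (christoffel g r p l x * christoffel g l q s x
                  - christoffel g r q l x * christoffel g l p s x).

Definition ricci (R : realType) (m : nat) (g : tensor_field R m) :
  tensor_field R m :=
  fun x => \matrix_(i, j) \sum_(k < m) riemann g k i k j x.

(* The time derivative is taken within I, hence one-sided at an end point of I
   that belongs to I. *)
Definition ricci_flow (R : realType) (m : nat) (I : set R)
    (g : R -> tensor_field R m) : Prop :=
  forall t, I t ->
    riemannian_metric (g t) /\
    forall x i j,
      (g u x i j - g t x i j) / (u - t) @[u --> within I t^']
        --> - 2 * ricci (g t) x i j.

Definition blowdown (R : realType) (m : nat) (g : R -> tensor_field R m)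
    (s t : R) : tensor_field R m :=
  fun x => s^-1 *: g (s * t) x.

Definition asymp_equiv (R : realType) (a b : R -> R) : Prop :=
  a t / b t @[t --> +oo] --> (1 : R).

(* The Heisenberg group, identified with R^(n + n + 1) by its global
   coordinates (a, b, c). *)

Notation heis R n := 'rV[R]_(n + n + 1).

Definition ia (n : nat) (k : 'I_n) : 'I_(n + n + 1) := lshift 1 (lshift n k).
Definition ib (n : nat) (k : 'I_n) : 'I_(n + n + 1) := lshift 1 (rshift n k).
Definition iN (n : nat) : 'I_(n + n + 1) := rshift (n + n) ord0.

Definition heis_mx (R : realType) (n : nat) (x : heis R n) :
    'M[R]_(1 + (n + 1)) :=
  block_mx 1%:M (row_mx (\row_k x 0 (ia k)) (x 0 (iN n))%:M)
           0 (block_mx 1%:M (\col_k x 0 (ib k)) 0 1%:M).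

Definition heis_mul (R : realType) (n : nat) (p q : heis R n) : heis R n :=
  p + q + (\sum_(k < n) p 0 (ia k) * q 0 (ib k)) *: delta_mx 0 (iN n).

(* Row I holds the components of theta^I in the dx^j. *)
Definition coframe (R : realType) (n : nat) (x : heis R n) :
    'M[R]_(n + n + 1) :=
  1%:M - \sum_(k < n) x 0 (ia k) *: delta_mx (iN n) (ib k).

(* sum_IJ G_IJ theta^I (x) theta^J *)
Definition left_invariant (R : realType) (n : nat) (G : 'M[R]_(n + n + 1)) :
    tensor_field R (n + n + 1) :=
  fun x => (coframe x)^T *m G *m coframe x.

(* Convergence, as the parameter s tends to infinity, of left-invariant tensor
   fields to left_invariant G, meaning convergence of their coefficients in the
   coframe. *)
Definition left_invariant_cvg (R : realType) (n : nat)
    (g : R -> tensor_field R (n + n + 1)) (G : 'M[R]_(n + n + 1)) : Prop :=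
  exists H : R -> 'M[R]_(n + n + 1),
    (forall s, 0 < s -> g s =1 left_invariant (H s)) /\
    forall I J, H s I J @[s --> +oo] --> G I J.

Definition nilsoliton_with (R : realType) (n : nat) (c : R -> R)
    (eta : R -> heis R n -> heis R n) (G : 'M[R]_(n + n + 1)) : Prop :=
  (forall t, 0 < t -> diffeomorphism (eta t)) /\
  ricci_flow `]0, +oo[
    (fun t x => c t *: pullback (eta t) (left_invariant G) x).

Definition expanding_nilsoliton (R : realType) (n : nat)
    (eta : R -> heis R n -> heis R n) (G : 'M[R]_(n + n + 1)) : Prop :=
  nilsoliton_with id eta G.

(* Coefficients of a sum_(i <= 2n) theta^i (x) theta^i + c theta^N (x) theta^N *)
Definition diag2 (R : realType) (n : nat) (a c : R) : 'M[R]_(n + n + 1) :=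
  block_mx a%:M 0 0 c%:M.

Definition ginf (R : realType) (n : nat) : 'M[R]_(n + n + 1) :=
  diag2 n 1 (n.+2%:R)^-1.

Definition ginf_flow (R : realType) (n : nat) (t : R) : 'M[R]_(n + n + 1) :=
  diag2 n (t `^ (1 / n.+2%:R)) ((n.+2%:R)^-1 * t `^ (- (n%:R / n.+2%:R))).

Definition eta (R : realType) (n : nat) (t : R) (x : heis R n) : heis R n :=
  row_mx (t `^ (- (2^-1 * (n.+1%:R / n.+2%:R))) *: lsubmx x)
         (t `^ (- (n.+1%:R / n.+2%:R)) *: rsubmx x).

(* Sanity checks: heis_mul is the matrix product, and the tensor fields
   left_invariant G are invariant under left translations. *)

Lemma heis_mxM (R : realType) (n : nat) (p q : heis R n) :
  heis_mx p *m heis_mx q = heis_mx (heis_mul p q).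
Proof.
have E1 (k : 'I_n) : heis_mul p q 0 (ia k) = p 0 (ia k) + q 0 (ia k).
  by rewrite !mxE eq_lrshift andbF mulr0 addr0.
have E2 (k : 'I_n) : heis_mul p q 0 (ib k) = p 0 (ib k) + q 0 (ib k).
  by rewrite !mxE eq_lrshift andbF mulr0 addr0.
have E3 : heis_mul p q 0 (iN n) =
    p 0 (iN n) + q 0 (iN n) + \sum_(k < n) p 0 (ia k) * q 0 (ib k).
  by rewrite !mxE !eqxx mulr1.
rewrite /heis_mx E3.
rewrite mulmx_block !mul1mx !mulmx0 !mul0mx addr0 add0r mul_row_block.
rewrite mulmx_block !mulmx1 !mulmx0 !mul0mx mul1mx !addr0 !add0r.
rewrite add_row_mx; congr block_mx; last congr block_mx.
- congr row_mx; first by apply/rowP => k; rewrite [RHS]mxE E1 !mxE addrC.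
  apply/matrixP => i j; rewrite !ord1 !mxE /= !mulr1n.
  under eq_bigr do rewrite !mxE.
  by rewrite addrA addrAC [in RHS](addrC (p _ _)).
- by apply/colP => k; rewrite [RHS]mxE E2 !mxE addrC.
Qed.

Lemma coframe_left_translation (R : realType) (n : nat) (p q : heis R n) :
  coframe (heis_mul p q) *m (jacobian (heis_mul p) q)^T = coframe q.
Proof.
pose A : 'M[R]_(n + n + 1) :=
  1%:M + \sum_(k < n) p 0 (ia k) *: delta_mx (ib k) (iN n).
have mulA (v : heis R n) : v *m A =
    v + (\sum_(k < n) p 0 (ia k) * v 0 (ib k)) *: delta_mx 0 (iN n).
  rewrite mulmxDr mulmx1 mulmx_sumr scaler_suml; congr (_ + _).
  apply: eq_bigr => k _; rewrite -scalemxAr -scalerA; congr (_ *: _).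
  apply/rowP => j; rewrite !mxE (bigD1 (ib k)) //= big1 ?addr0.
    by rewrite !mxE !eqxx.
  by move=> i /negbTE ik; rewrite !mxE ik mulr0.
have Acont : continuous (mulmxr A : heis R n -> heis R n).
  have -> : (mulmxr A : heis R n -> heis R n) =
      (fun v => v + (\sum_(k < n) p 0 (ia k) * v 0 (ib k))
                    *: delta_mx 0 (iN n)).
    by apply/funext => v /=; rewrite mulA.
  pose F k (u : heis R n) : R := p 0 (ia k) * u 0 (ib k).
  have Fc k : continuous (F k).
    move=> u; have cc : continuous (fun u : heis R n => u 0 (ib k)).
      exact: coord_continuous.
    by have := cc u; rewrite /continuous_at => h; exact: cvgMl_tmp h.
  have sumc : continuous (fun u => \sum_(k < n) F k u).
    apply: (@continuous_big _ _ _ _ _ _ _ _ F) => [|k _].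
      exact: add_continuous.
    exact: Fc.
  move=> v; apply: (@continuousD _ _ _ id); first by move=> ?.
  by have := sumc v; rewrite /continuous_at => h; exact: cvgZr_tmp h.
have JE : jacobian (heis_mul p) q = A.
  have -> : heis_mul p = cst p + (mulmxr A : heis R n -> heis R n).
    by apply/funext => v; rewrite /heis_mul -addrA -mulA.
  rewrite /jacobian.
  have dA : is_diff q (mulmxr A : heis R n -> heis R n) (mulmxr A).
    apply: DiffDef; first exact: linear_differentiable.
    exact: diff_lin.
  have dT := is_diffD (is_diff_cst p q) dA.
  rewrite (@diff_val _ _ _ _ _ _ _ dT) add0r.
  by apply/row_matrixP => i; rewrite !rowE mul_rV_lin1.
pose N (c : 'I_n -> R) : 'M[R]_(n + n + 1) :=
  \sum_(k < n) c k *: delta_mx (iN n) (ib k).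
have NN c d : N c *m N d = 0.
  rewrite mulmx_suml big1 // => k _; rewrite mulmx_sumr big1 // => l _.
  by rewrite -scalemxAl -scalemxAr mul_delta_mx_0 ?scaler0 // eq_lrshift.
have AE : A^T = 1%:M + N (fun k => p 0 (ia k)).
  rewrite /A linearD /= trmx1 linear_sum; congr (_ + _).
  by apply: eq_bigr => k _; rewrite linearZ /= trmx_delta.
have CE : coframe (heis_mul p q) =
    1%:M - N (fun k => p 0 (ia k)) - N (fun k => q 0 (ia k)).
  rewrite /coframe -addrA -opprD -big_split; congr (_ - _).
  apply: eq_bigr => k _; rewrite /= -scalerDl; congr (_ *: _).
  by rewrite !mxE eq_lrshift andbF mulr0 addr0.
by rewrite JE AE CE mulmxDr mulmx1 !mulmxBl mul1mx !NN !subr0 addrAC subrK.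
Qed.

Lemma pullback_left_translation (R : realType) (n : nat)
    (G : 'M[R]_(n + n + 1)) (p : heis R n) :
  pullback (heis_mul p) (left_invariant G) =1 left_invariant G.
Proof.
move=> q; rewrite /pullback /left_invariant -(coframe_left_translation p q).
by rewrite trmx_mul trmxK !mulmxA.
Qed.

(* Main.v *)
Require Import Defs.
From mathcomp Require Import all_boot all_order all_algebra.
From mathcomp Require Import all_classical all_reals all_analysis.
From mathcomp Require Import ring lra.
Import Order.TTheory GRing.Theory Num.Theory.
Import numFieldNormedType.Exports.
Local Open Scope classical_set_scope.
Local Open Scope ring_scope.

Set Implicit Arguments.
Unset Strict Implicit.
Unset Printing Implicit Defensive.

(** The Ricci tensor of a left-invariant metric [G] on the Heisenberg group is
    computed in the global coordinates, for an arbitrary inner product [G]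
    ([ricci_left_invariant]). With [Om] the matrix of the Lie bracket, the flow is
    the system of ordinary differential equations
      [G' = G_NN Om G^-1 Om^T + (tr (G^-1 Om G^-1 Om) / 2) (G e_N) (G e_N)^T].

    Diagonality is preserved without any uniqueness theorem ([flow_diag]). The
    entries of the last column of [G] all satisfy one linear equation, so those
    that vanish initially vanish forever. Then [S = Om G Om^T G] satisfies
    [S' = 2 G_NN Pi], where [Pi] kills the centre: the inverse metric has
    disappeared. Thus [S] stays diagonal, and this in turn makes the equation of
    each other column linear with a scalar coefficient.

    For a diagonal solution the quotient of the coefficients of two conjugate
    directions is constant. Their geometric means [x_k] and [z = G_NN] satisfy
    [x_k' = z / x_k] and [z' = - z^2 sum_k x_k^-2]. Consequently
    [kappa = z prod_k x_k] and all [x_k^2 - x_l^2] are constant. The derivative of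
    [x_k^(n+2)] is [(n+2) z x_k^n], which is at least [(n+2) kappa] for the largest
    [x_k] and at most that for the smallest one, while the two remain at bounded
    distance. So every [x_k] is [((n+2) kappa t)^(1/(n+2))] up to a factor tending
    to [1] ([diag_asymp]), and [z] follows from [kappa] ([diag_asympN]).

    The leading coefficients of conjugate directions have a product independent of
    the pair ([heis_gamma_ab]). Hence they can all be normalized by diagonal group
    automorphisms, whose pullback acts on left-invariant metrics by rescaling the
    coefficients ([pullback_dilation]); that gives the convergence of the blowdowns
    ([blowdown_cvg]). The maps [eta] are automorphisms of the same kind, so the
    soliton statement reduces to the two scalar equations of [ricci_diag2]. *)

(** * Pointwise calculus *)

Section Calculus.
Variables (R : realType) (V : normedModType R).
Implicit Types (f g : V -> R) (x v : V) (a b : R).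

Lemma is_derive_fcst x v a : is_derive x v (fun=> a) 0.
Proof. exact: is_derive_cst. Qed.

Lemma is_derive_fD x v f g a b : is_derive x v f a -> is_derive x v g b ->
  is_derive x v (fun y => f y + g y) (a + b).
Proof. exact: is_deriveD. Qed.

Lemma is_derive_fB x v f g a b : is_derive x v f a -> is_derive x v g b ->
  is_derive x v (fun y => f y - g y) (a - b).
Proof. exact: is_deriveB. Qed.

Lemma is_derive_fM x v f g a b : is_derive x v f a -> is_derive x v g b ->
  is_derive x v (fun y => f y * g y) (a * g x + f x * b).
Proof.
move=> df dg; have -> : a * g x + f x * b = f x *: b + g x *: a.
  by rewrite addrC [a * _]mulrC.
exact: is_deriveM.
Qed.

Lemma is_derive_fsum x v m (h : 'I_m -> V -> R) (dh : 'I_m -> R) :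
  (forall i, is_derive x v (h i) (dh i)) ->
  is_derive x v (fun y => \sum_(i < m) h i y) (\sum_(i < m) dh i).
Proof.
move=> dhE; rewrite (_ : (fun _ => _) = \sum_(i < m) h i).
  exact: is_derive_sum.
by apply/funext => y; rewrite fct_sumE.
Qed.

End Calculus.


Section Smooth.
Variables (R : realType) (m : nat).
Implicit Types f g : 'rV[R]_m -> R.

Lemma partialE f i x d : is_derive x (delta_mx 0 i) f d -> partial i f x = d.
Proof. by move=> df; rewrite /partial derive_val. Qed.

(** The Leibniz rule also involves the undifferentiated factors, so products need
    this. *)
Lemma Ck_le k f : Ck k.+1 f -> Ck k f.
Proof.
elim: k f => [|k IH] f [cf df]; first by split.
by split => // i; have [di /IH] := df i.
Qed.

Lemma Ck_cst k a : Ck k (fun _ : 'rV[R]_m => a).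
Proof.
elim: k a => [|k IH] a; split=> //; try exact: cst_continuous.
move=> i; split; first by move=> x; exact: derivable_cst.
rewrite (_ : partial i _ = fun=> 0); first exact: IH.
by apply/funext => x; apply: partialE; exact: is_derive_fcst.
Qed.

Lemma is_derive_coord (j : 'I_m) (x v : 'rV[R]_m) :
  is_derive x v (fun y : 'rV[R]_m => y 0 j) (v 0 j).
Proof.
have H : (fun h => h^-1 *: ((fun y : 'rV[R]_m => y 0 j) \o shift x) (h *: v)
     - h^-1 *: (x 0 j)) @ 0^' --> v 0 j.
  apply: cvg_near_cst; near=> h.
  rewrite /= !mxE -scalerBr addrK /GRing.scale /= mulKf //.
  by near: h; exact: nbhs_dnbhs_neq.
have E : (fun h => h^-1 *: (((fun y : 'rV[R]_m => y 0 j) \o shift x) (h *: v)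
     - x 0 j)) @ 0^' --> v 0 j.
  by under eq_fun do rewrite scalerBr.
split; first by apply/cvg_ex; exists (v 0 j).
exact: cvg_lim.
Unshelve. all: by end_near. Qed.

Lemma Ck_coord k (j : 'I_m) : Ck k (fun y : 'rV[R]_m => y 0 j).
Proof.
case: k => [|k]; split=> //; try exact: coord_continuous.
move=> i; split; first by move=> x; case: (is_derive_coord j x (delta_mx 0 i)).
rewrite (_ : partial i _ = fun=> (delta_mx 0 i : 'rV[R]_m) 0 j).
  exact: Ck_cst.
by apply/funext => x; apply: partialE; exact: is_derive_coord.
Qed.

Let contD f g : continuous f -> continuous g ->
  continuous (fun x => f x + g x).
Proof. by move=> cf cg x; exact: (cvgD (cf x) (cg x)). Qed.

Let contM f g : continuous f -> continuous g ->
  continuous (fun x => f x * g x).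
Proof. by move=> cf cg x; exact: (cvgM (cf x) (cg x)). Qed.

Lemma CkD k f g : Ck k f -> Ck k g -> Ck k (fun x => f x + g x).
Proof.
elim: k f g => [|k IH] f g [cf df] [cg dg]; split=> //;
  try exact: contD.
move=> i; have [dfi pf] := df i; have [dgi pg] := dg i; split.
  by move=> x; apply: derivableD.
rewrite (_ : partial i _ = fun x => partial i f x + partial i g x).
  exact: IH.
apply/funext => x; apply: partialE.
by apply: is_derive_fD; apply: derivableP.
Qed.

Lemma CkM k f g : Ck k f -> Ck k g -> Ck k (fun x => f x * g x).
Proof.
elim: k f g => [|k IH] f g /[dup] Cf [cf df] /[dup] Cg [cg dg]; split=> //;
  try exact: contM.
move=> i; have [dfi pf] := df i; have [dgi pg] := dg i; split.
  by move=> x; apply: derivableM.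
rewrite (_ : partial i _ = fun x => partial i f x * g x + f x * partial i g x).
  by apply: CkD; apply: IH => //; exact: Ck_le.
apply/funext => x; apply: partialE.
by apply: is_derive_fM; apply: derivableP.
Qed.

Lemma smooth_cst a : smooth (fun _ : 'rV[R]_m => a).
Proof. by move=> k; exact: Ck_cst. Qed.

Lemma smooth_coord (j : 'I_m) : smooth (fun y : 'rV[R]_m => y 0 j).
Proof. by move=> k; exact: Ck_coord. Qed.

Lemma smoothD f g : smooth f -> smooth g -> smooth (fun x => f x + g x).
Proof. by move=> sf sg k; exact: CkD. Qed.

Lemma smoothM f g : smooth f -> smooth g -> smooth (fun x => f x * g x).
Proof. by move=> sf sg k; exact: CkM. Qed.

Lemma smooth_sum (I : Type) (r : seq I) (f : I -> 'rV[R]_m -> R) :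
  (forall i, smooth (f i)) -> smooth (fun x => \sum_(i <- r) f i x).
Proof.
move=> sf; elim: r => [|i r IH].
  by under eq_fun do rewrite big_nil; exact: smooth_cst.
by under eq_fun do rewrite big_cons; exact: smoothD.
Qed.

Lemma smooth_lin p (A : 'M[R]_(m, p)) j :
  smooth (fun x : 'rV[R]_m => (x *m A) 0 j).
Proof.
under eq_fun do rewrite mxE.
apply: smooth_sum => i; apply: smoothM; [exact: smooth_coord|exact: smooth_cst].
Qed.

Lemma is_derive_lin p (A : 'M[R]_(m, p)) j (x v : 'rV[R]_m) :
  is_derive x v (fun x : 'rV[R]_m => (x *m A) 0 j) ((v *m A) 0 j).
Proof.
under eq_fun do rewrite mxE.
rewrite mxE; apply: is_derive_fsum => i.
apply: is_derive_eq.
  exact: (is_derive_fM (is_derive_coord _ _ _) (is_derive_fcst _ _ _)).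
by rewrite mulr0 addr0.
Qed.

Lemma jacobian_lin (A : 'M[R]_m) (x : 'rV[R]_m) :
  jacobian (fun y : 'rV[R]_m => y *m A) x = A.
Proof.
pose f : 'rV[R]_m -> 'rV[R]_m := mulmxr A.
have cf : continuous f.
  pose F i (y : 'rV[R]_m) := y 0 i *: row i A.
  have -> : f = fun y => \sum_i F i y.
    by apply/funext => y; rewrite /f /= mulmx_sum_row.
  apply: (@continuous_big _ _ _ _ _ _ _ _ F); [exact: add_continuous|move=> i _].
  have cc : continuous (fun u : 'rV[R]_m => u 0 i) by exact: coord_continuous.
  by move=> y; have := cc y; rewrite /continuous_at => h; exact: cvgZr_tmp h.
rewrite /jacobian (_ : (fun _ => _) = f) // diff_lin //.
by apply/row_matrixP => i; rewrite !rowE mul_rV_lin1.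
Qed.

End Smooth.

(** * The Ricci tensor of a left-invariant metric *)

Section Heisenberg.
Variables (R : realType) (n : nat).
Local Notation M := 'M[R]_(n + n + 1).
Local Notation N := (iN n).
Implicit Types (x : heis R n) (G : M).

(** The bilinear form giving the last component of the group law: the product of
    [p] and [q] is their sum plus [p *m U *m q^T] along the centre. *)
Definition heis_pairing : M := \sum_(k < n) delta_mx (ia k) (ib k).

(** The Lie bracket: [F_i, F_j] is the [(i, j)] entry times [F_N]. *)
Definition heis_bracket : M := heis_pairing - heis_pairing^T.

Definition eN : 'cV[R]_(n + n + 1) := delta_mx N 0.

Local Notation U := heis_pairing.
Local Notation Om := heis_bracket.

Lemma ia_neqN (k : 'I_n) : (ia k == N) = false.
Proof. by rewrite eq_lrshift. Qed.

Lemma ib_neqN (k : 'I_n) : (ib k == N) = false.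
Proof. by rewrite eq_lrshift. Qed.

Lemma ia_neq_ib (k l : 'I_n) : (ia k == ib l) = false.
Proof. by rewrite eq_lshift eq_lrshift. Qed.

Lemma eq_ia (k l : 'I_n) : (ia k == ia l) = (k == l).
Proof. by rewrite !eq_lshift. Qed.

Lemma eq_ib (k l : 'I_n) : (ib k == ib l) = (k == l).
Proof. by rewrite eq_lshift eq_rshift. Qed.

Lemma heisU_eN : U *m eN = 0.
Proof.
rewrite /heis_pairing mulmx_suml big1 // => k _.
by rewrite mul_delta_mx_0 // ib_neqN.
Qed.

Lemma heisUT_eN : U^T *m eN = 0.
Proof.
rewrite /heis_pairing linear_sum mulmx_suml big1 // => k _.
by rewrite /= trmx_delta mul_delta_mx_0 // ia_neqN.
Qed.

Lemma heisUU : U *m U = 0.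
Proof.
rewrite /heis_pairing mulmx_suml big1 // => k _; rewrite mulmx_sumr big1 // => l _.
by rewrite mul_delta_mx_0 // eq_sym ia_neq_ib.
Qed.

Lemma heisUUT : U *m U^T = \sum_(k < n) delta_mx (ia k) (ia k).
Proof.
rewrite /heis_pairing mulmx_suml; apply: eq_bigr => k _.
rewrite linear_sum mulmx_sumr (bigD1 k) //= trmx_delta mul_delta_mx big1 ?addr0//.
by move=> l lk; rewrite trmx_delta mul_delta_mx_0 // eq_ib eq_sym.
Qed.

Lemma heisUTU : U^T *m U = \sum_(k < n) delta_mx (ib k) (ib k).
Proof.
rewrite /heis_pairing [X in X *m _]linear_sum mulmx_suml; apply: eq_bigr => k _.
rewrite mulmx_sumr (bigD1 k) //= trmx_delta mul_delta_mx big1 ?addr0//.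
by move=> l lk; rewrite mul_delta_mx_0 // eq_ia eq_sym.
Qed.

Lemma heis_indexP (I : 'I_(n + n + 1)) :
  [\/ exists k, I = ia k, exists k, I = ib k | I = N].
Proof.
case: (split_ordP I) => [J ->|j ->]; last by constructor 3; rewrite (ord1 j).
by case: (split_ordP J) => k ->; [constructor 1|constructor 2]; exists k.
Qed.

Lemma heisO_eN : Om *m eN = 0.
Proof. by rewrite mulmxBl heisU_eN heisUT_eN subrr. Qed.

Lemma heisOT : Om^T = - Om.
Proof. by rewrite linearB /= trmxK opprB. Qed.

Lemma eNT_heisO : eN^T *m Om = 0.
Proof.
by apply: trmx_inj; rewrite trmx_mul trmxK heisOT mulNmx heisO_eN oppr0 trmx0.
Qed.

Lemma eNT_heisU : eN^T *m U = 0.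
Proof. by apply: trmx_inj; rewrite trmx_mul trmxK heisUT_eN trmx0. Qed.

Lemma heisOOT : Om *m Om^T = 1%:M - eN *m eN^T.
Proof.
have -> : Om *m Om^T = U *m U^T + U^T *m U.
  have UUT : U^T *m U^T = 0 by rewrite -trmx_mul heisUU trmx0.
  rewrite [Om^T]linearB /= trmxK mulmxBr !mulmxBl heisUU UUT.
  by rewrite subr0 sub0r opprK.
rewrite heisUUT heisUTU trmx_delta mul_delta_mx [in RHS]mx1_sum_delta.
by rewrite !big_split_ord /= big_ord1 addrK.
Qed.

(** Only the last coframe element is not closed: the coframe differs from the
    coordinate one by a rank one term, linear in the coordinates. *)
Lemma coframeE x : coframe x = 1%:M - eN *m (x *m U).
Proof.
rewrite /coframe /heis_pairing mulmx_sumr mulmx_sumr; congr (_ - _).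
apply: eq_bigr => k _.
have -> : x *m delta_mx (ia k) (ib k) = x 0 (ia k) *: delta_mx 0 (ib k).
  rewrite -(mul_delta_mx (0 : 'I_1)) mulmxA -colE [col _ _]mx11_scalar.
  by rewrite mul_scalar_mx mxE.
by rewrite -scalemxAr mul_delta_mx.
Qed.

Lemma rowU_eN x : x *m U *m eN = 0.
Proof. by rewrite -mulmxA heisU_eN mulmx0. Qed.

Lemma coframe_eN x : coframe x *m eN = eN.
Proof. by rewrite coframeE mulmxBl mul1mx -mulmxA rowU_eN mulmx0 subr0. Qed.

Lemma coframeV x : coframe x *m (1%:M + eN *m (x *m U)) = 1%:M.
Proof.
rewrite mulmxDr mulmx1 mulmxA coframe_eN coframeE -addrA [- _ + _]addrC.
by rewrite subrr addr0.
Qed.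

Lemma coframe_unit x : coframe x \in unitmx.
Proof. by case: (mulmx1_unit (coframeV x)). Qed.

Lemma heisO_coframe x : Om *m coframe x = Om.
Proof. by rewrite coframeE mulmxBr mulmx1 (mulmxA Om) heisO_eN mul0mx subr0. Qed.

Lemma coframeT_heisO x : (coframe x)^T *m Om = Om.
Proof.
apply: trmx_inj; rewrite trmx_mul trmxK heisOT.
by rewrite mulNmx heisO_coframe.
Qed.

(** The matrix of [heis_Gamma k i j x] in [k] and [j] is a multiple of [heis_L x]
    plus two rank one terms, and nearly all the pairings between their factors and
    with [heis_L x] vanish. *)
Lemma mxtrace_rank_one m (A : 'M[R]_m) (l l' e : 'cV[R]_m) (r t t' : 'rV[R]_m)
    (a a' c : R) :
  A *m e = 0 -> r *m A = 0 -> r *m l = 0 -> r *m l' = 0 ->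
  t *m e = 0 -> t' *m e = 0 -> r *m e = c%:M ->
  \tr ((a *: A + l *m r - e *m t) *m (a' *: A + l' *m r - e *m t')) =
  a * a' * \tr (A *m A) - c * \tr (t' *m l) - c * \tr (t *m l').
Proof.
move=> Ae rA rl rl' te t'e re.
have trB (B C : 'M[R]_m) : \tr (B - C) = \tr B - \tr C by exact: raddfB.
rewrite mulmxBr mulmxDr !(mulmxBl, mulmxDl) !(trB, mxtraceD).
rewrite -!scalemxAl -!scalemxAr !linearZ /= !mulmxA.
rewrite -!(mulmxA _ _ e) Ae te re -!(mulmxA _ r) rA rl'.
rewrite !(mulmx0, mul0mx) !mul_mx_scalar -!scalemxAl !linearZ /=.
rewrite [\tr (A *m l' *m r)]mxtrace_mulC [\tr (e *m t *m A)]mxtrace_mulC.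
rewrite [\tr (e *m t *m l' *m r)]mxtrace_mulC.
rewrite !mulmxA Ae rA re !mul0mx !mul_scalar_mx -!scalemxAl linearZ /=.
rewrite [\tr (l *m t')]mxtrace_mulC !mxtrace0 /GRing.scale /=; ring.
Qed.

Section Metric.
Variable G : M.
Hypothesis Gsym : G^T = G.
Hypothesis Gunit : G \in unitmx.

Local Notation H := (invmx G).
Local Notation nuN := (G N N).
Local Notation u x i := ((x *m U) 0 i).

(** The coordinate components of the one-form dual to [F_N] for the metric. *)
Definition heis_mu x : 'cV[R]_(n + n + 1) := (coframe x)^T *m (G *m eN).
Local Notation mu x i := (heis_mu x i 0).

(** In coordinates, the endomorphism obtained from the bracket form by raising an
    index with the metric; it carries, with [heis_mu], the Levi-Civita connection. *)
Definition heis_L x : M := (1%:M + eN *m (x *m U)) *m (H *m Om).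
Local Notation L := heis_L.

Let mulmx_eN p (A : 'M[R]_(p, n + n + 1)) i : (A *m eN) i 0 = A i N.
Proof. by rewrite -colE mxE. Qed.

Let mul_delta p (A : 'M[R]_(p, n + n + 1)) (i : 'I_(n + n + 1)) (j : 'I_p) :
  (A *m delta_mx i (0 : 'I_1)) j 0 = A j i.
Proof. by rewrite -colE mxE. Qed.

Let mulmx_col_row p q (c : 'cV[R]_p) (r : 'rV[R]_q) i j :
  (c *m r) i j = c i 0 * r 0 j.
Proof. by rewrite mxE big_ord1. Qed.

Let mxDE p q (A B : 'M[R]_(p, q)) i j : (A + B) i j = A i j + B i j.
Proof. by rewrite mxE. Qed.

Let mxBE p q (A B : 'M[R]_(p, q)) i j : (A - B) i j = A i j - B i j.
Proof. by rewrite !mxE. Qed.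

Let mxZE p q (A : 'M[R]_(p, q)) a i j : (a *: A) i j = a * A i j.
Proof. by rewrite mxE. Qed.

Let mxNE p q (A : 'M[R]_(p, q)) i j : (- A) i j = - A i j.
Proof. by rewrite mxE. Qed.

Let mxTE p q (A : 'M[R]_(p, q)) i j : A^T i j = A j i.
Proof. by rewrite mxE. Qed.

Let eNTmul p (A : 'M[R]_(_, p)) j : (eN^T *m A) 0 j = A N j.
Proof. by rewrite trmx_delta -rowE mxE. Qed.

Let eN_mul (v : 'rV[R]_(n + n + 1)) i j : (eN *m v) i j = (i == N)%:R * v 0 j.
Proof. by rewrite mxE big_ord1 mxE eqxx andbT. Qed.

Lemma heis_muE x i : mu x i = G i N - u x i * nuN.
Proof.
rewrite /heis_mu coframeE linearB /= trmx1 mulmxBl mul1mx mxBE mulmx_eN.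
congr (_ - _).
by rewrite trmx_mul -mulmxA mulmx_col_row eNTmul mulmx_eN mxTE.
Qed.

Lemma heis_muN x : mu x N = nuN.
Proof.
rewrite heis_muE; have -> : u x N = (x *m U *m eN) 0 0 by rewrite mulmx_eN.
by rewrite rowU_eN mxE mul0r subr0.
Qed.

Lemma left_invariantE x i j : left_invariant G x i j =
  G i j - u x i * G N j - G i N * u x j + nuN * (u x i * u x j).
Proof.
have -> : left_invariant G x = (coframe x)^T *m G - heis_mu x *m (x *m U).
  by rewrite /left_invariant {2}coframeE mulmxBr mulmx1 /heis_mu !mulmxA.
have -> : (coframe x)^T *m G = G - (x *m U)^T *m (eN^T *m G).
  by rewrite coframeE linearB /= trmx1 mulmxBl mul1mx trmx_mul mulmxA.
by rewrite !mxBE !mulmx_col_row eNTmul mxTE heis_muE; ring.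
Qed.

Lemma is_derive_u x k i : is_derive x (delta_mx 0 k) (fun y => u y i) (U k i).
Proof.
apply: is_derive_eq; first exact: is_derive_lin.
by rewrite -rowE mxE.
Qed.

Lemma partial_left_invariant x i j l :
  partial i (fun y => left_invariant G y j l) x =
  - (U i j * mu x l) - U i l * mu x j.
Proof.
apply: partialE; under eq_fun do rewrite left_invariantE.
apply: is_derive_eq.
  exact: (is_derive_fD
    (is_derive_fB
      (is_derive_fB (is_derive_fcst _ _ _)
        (is_derive_fM (is_derive_u _ _ _) (is_derive_fcst _ _ _)))
      (is_derive_fM (is_derive_fcst _ _ _) (is_derive_u _ _ _)))
    (is_derive_fM (is_derive_fcst _ _ _)
      (is_derive_fM (is_derive_u _ _ _) (is_derive_u _ _ _)))).
rewrite !heis_muE; have -> : G N l = G l N by rewrite -{1}Gsym mxE.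
by ring.
Qed.

Lemma left_invariant_unit x : left_invariant G x \in unitmx.
Proof. by rewrite /left_invariant !unitmx_mul unitmx_tr coframe_unit Gunit. Qed.

Lemma left_invariant_eN x : left_invariant G x *m eN = heis_mu x.
Proof. by rewrite /left_invariant -!mulmxA coframe_eN. Qed.

(** This and [left_invariant_eN] let the inverse metric be applied to the
    derivatives of the metric without computing it at [x]. *)
Lemma left_invariant_L x : left_invariant G x *m L x = Om.
Proof.
rewrite /left_invariant /L -!mulmxA (mulmxA (coframe x)) coframeV mul1mx.
by rewrite mulKVmx // coframeT_heisO.
Qed.

Local Notation T := (U + U^T).

(** The first two terms are the tensorial part of the connection in the
    left-invariant frame; the last one accounts for the coframe not being closed
    and absorbs the antisymmetric part of the frame connection. *)
Definition heis_Gamma k i j x : R :=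
  2^-1 * (L x k j * mu x i + L x k i * mu x j - T i j * (k == N)%:R).

Lemma christoffel_left_invariant k i j x :
  christoffel (left_invariant G) k i j x = heis_Gamma k i j x.
Proof.
rewrite /christoffel /heis_Gamma; congr (_ * _).
pose v := mu x i *: col j (L x) + mu x j *: col i (L x) - T i j *: eN.
have -> : L x k j * mu x i + L x k i * mu x j - T i j * (k == N)%:R = v k 0.
  by rewrite !mxE eqxx andbT; ring.
rewrite -[v](mulKmx (left_invariant_unit x)) mxE; apply: eq_bigr => l _.
congr (_ * _); rewrite !partial_left_invariant.
rewrite mulmxBr mulmxDr -!scalemxAr left_invariant_eN.
rewrite !colE !(mulmxA _ (L x)) left_invariant_L.
by rewrite mxBE !mxDE !mxZE !mul_delta !mxBE !mxTE; ring.
Qed.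

Lemma heis_L_eN x : L x *m eN = 0.
Proof. by rewrite /L -!mulmxA heisO_eN !mulmx0. Qed.

Lemma heis_mu_L x : (heis_mu x)^T *m L x = 0.
Proof.
rewrite /heis_mu /L !trmx_mul trmxK -!mulmxA (mulmxA (coframe x)) coframeV mul1mx.
by rewrite Gsym mulKVmx // eNT_heisO.
Qed.

Lemma mxtrace_heis_L_sqr x : \tr (L x *m L x) = \tr (H *m Om *m (H *m Om)).
Proof.
rewrite /L; set P := 1%:M + _; set K := H *m Om.
have KP : K *m P = K.
  rewrite mulmxDr mulmx1 (mulmxA K) -(mulmxA H) heisO_eN mulmx0 mul0mx.
  by rewrite addr0.
by rewrite (mulmxA (P *m K)) -(mulmxA P K P) KP -mulmxA mxtrace_mulC -mulmxA KP.
Qed.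

Lemma heisUT_L x : U^T *m L x = U^T *m (H *m Om).
Proof. by rewrite /L mulmxA mulmxDr mulmx1 mulmxA heisUT_eN mul0mx addr0. Qed.

Lemma heisT_L x : T *m L x = T *m (H *m Om).
Proof.
have TeN : T *m eN = 0 by rewrite mulmxDl heisUT_eN heisU_eN addr0.
by rewrite /L mulmxA mulmxDr mulmx1 (mulmxA T) TeN mul0mx addr0.
Qed.

Lemma mxtrace_heis_L x : \tr (L x) = 0.
Proof.
rewrite /L mulmxDl mul1mx mxtraceD -mulmxA [\tr (eN *m _)]mxtrace_mulC.
rewrite -!mulmxA heisO_eN !mulmx0 mxtrace0 addr0.
have HT : H^T = H by rewrite trmx_inv Gsym.
(* The product of a symmetric and a skew matrix has a trace equal to its
   opposite. *)
have := mxtrace_tr (H *m Om); rewrite trmx_mul HT heisOT mulNmx mxtrace_mulC.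
rewrite linearN /= => E; apply/eqP; rewrite -[_ == 0](mulrn_eq0 _ 2) mulr2n -{1}E.
by rewrite addNr.
Qed.

(** The contracted symbols are the logarithmic derivatives of the volume density,
    which is constant because the coframe is unipotent. *)
Lemma sum_heis_Gamma_diag i x : \sum_k heis_Gamma k k i x = 0.
Proof.
rewrite -mulr_sumr big_split big_split /= -mulr_suml.
have -> : \sum_k L x k i * mu x k = 0.
  have E : ((heis_mu x)^T *m L x) 0 i = 0 by rewrite heis_mu_L mxE.
  rewrite mxE in E; rewrite -[RHS]E; apply: eq_bigr => k _.
  by rewrite mulrC mxTE.
have -> : \sum_k L x k k = 0 := mxtrace_heis_L x.
rewrite mul0r.
rewrite (bigD1 N) //= big1 => [|k /negbTE ->]; last by rewrite mulr0 oppr0.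
have -> : T N i = 0; last by rewrite !(mul0r, addr0, oppr0, mulr0).
have TN : eN^T *m T = 0.
  apply: trmx_inj; rewrite trmx_mul trmxK linearD /= trmxK mulmxDl.
  by rewrite heisUT_eN heisU_eN addr0 trmx0.
by rewrite -eNTmul TN mxE.
Qed.

Lemma is_derive_mu x k i :
  is_derive x (delta_mx 0 k) (fun y => mu y i) (- (U k i * nuN)).
Proof.
under eq_fun do rewrite heis_muE.
apply: is_derive_eq.
  exact: (is_derive_fB (is_derive_fcst _ _ _)
    (is_derive_fM (is_derive_u _ _ _) (is_derive_fcst _ _ _))).
by rewrite mulr0 addr0 sub0r.
Qed.

Lemma is_derive_L x k i j :
  is_derive x (delta_mx 0 k) (fun y => L y i j)
    ((i == N)%:R * (U *m (H *m Om)) k j).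
Proof.
have E y : L y i j = (H *m Om) i j + (i == N)%:R * (y *m (U *m (H *m Om))) 0 j.
  by rewrite /L mulmxDl mul1mx -mulmxA -mulmxA mxE eN_mul.
under eq_fun do rewrite E.
apply: is_derive_eq.
  exact: (is_derive_fD (is_derive_fcst _ _ _)
    (is_derive_fM (is_derive_fcst _ _ _) (is_derive_lin _ _ _ _))).
by rewrite -rowE mul0r !add0r [row _ _ _ _]mxE.
Qed.

Lemma is_derive_Gamma x l k i j :
  is_derive x (delta_mx 0 l) (heis_Gamma k i j)
   (2^-1 * ((k == N)%:R * (U *m (H *m Om)) l j * mu x i - L x k j * (U l i * nuN)
     + ((k == N)%:R * (U *m (H *m Om)) l i * mu x j - L x k i * (U l j * nuN)))).
Proof.
rewrite /heis_Gamma; apply: is_derive_eq.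
  exact: (is_derive_fM (is_derive_fcst _ _ _)
    (is_derive_fB
      (is_derive_fD
        (is_derive_fM (is_derive_L _ _ _ _) (is_derive_mu _ _ _))
        (is_derive_fM (is_derive_L _ _ _ _) (is_derive_mu _ _ _)))
      (is_derive_fcst _ _ _))).
by rewrite /=; ring.
Qed.

Lemma sum_partial_Gamma x i j : \sum_k partial k (heis_Gamma k i j) x =
  - (nuN / 2) * ((U^T *m (H *m Om)) i j + (U^T *m (H *m Om)) j i).
Proof.
have UKN l : (U *m (H *m Om)) N l = 0.
  by rewrite -eNTmul mulmxA eNT_heisU mul0mx mxE.
rewrite -(heisUT_L x) ![(_ *m L x) _ _]mxE -big_split mulr_sumr.
apply: eq_bigr => k _; rewrite (partialE (is_derive_Gamma x k k i j)).
have Z l : (k == N)%:R * (U *m (H *m Om)) k l = 0.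
  by have [->|] := eqVneq k N; rewrite ?UKN ?mulr0 ?mul0r.
by rewrite !Z !mxTE /=; field.
Qed.

Lemma sum_Gamma_Gamma x i j :
  \sum_k \sum_l heis_Gamma k j l x * heis_Gamma l k i x =
  4^-1 * (mu x i * mu x j * \tr (H *m Om *m (H *m Om))
          - nuN * ((T *m (H *m Om)) i j + (T *m (H *m Om)) j i)).
Proof.
pose X i : M := mu x i *: L x + col i (L x) *m (heis_mu x)^T - eN *m row i T.
have colL a k : (col a (L x)) k 0 = L x k a by rewrite mxE.
have rowT a k : (row a T) 0 k = T a k by rewrite mxE.
have eNE k : eN k 0 = (k == N)%:R by rewrite mxE eqxx andbT.
have GX k a l : heis_Gamma k a l x = 2^-1 * X a k l.
  rewrite /heis_Gamma /X [in RHS]mxBE [in RHS]mxDE [in RHS]mxZE.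
  rewrite !mulmx_col_row colL rowT mxTE eNE.
  by ring.
have Tsy a b : T a b = T b a by rewrite !mxDE !mxTE addrC.
have Gsy k a b : heis_Gamma k a b x = heis_Gamma k b a x.
  by rewrite /heis_Gamma (Tsy a b) [_ * mu x a + _]addrC.
transitivity (4^-1 * \tr (X j *m X i)).
  rewrite /mxtrace mulr_sumr; apply: eq_bigr => k _.
  rewrite mxE mulr_sumr; apply: eq_bigr => l _.
  by rewrite (Gsy _ k) !GX; field.
congr (_ * _); rewrite -(mxtrace_heis_L_sqr x) -(heisT_L x).
have muLc a : (heis_mu x)^T *m col a (L x) = 0.
  by rewrite colE mulmxA heis_mu_L mul0mx.
have mueN : (heis_mu x)^T *m eN = nuN%:M.
  by rewrite [LHS]mx11_scalar mulmx_eN mxTE heis_muN.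
have TeN a : row a T *m eN = 0.
  by rewrite rowE -mulmxA mulmxDl heisUT_eN heisU_eN addr0 mulmx0.
have TL a b : row a T *m col b (L x) = ((T *m L x) a b)%:M.
  by rewrite rowE colE mulmxA -(mulmxA _ T) -rowE -colE [LHS]mx11_scalar !mxE.
rewrite (mxtrace_rank_one _ _ (heis_L_eN x) (heis_mu_L x) (muLc j) (muLc i)
  (TeN j) (TeN i) mueN) !TL !mxtrace_scalar.
by ring.
Qed.

(** For a diagonal metric the first term is the Ricci tensor across the centre and
    the second one the Ricci tensor along it; the trace is minus the square norm of
    the bracket form. By [sum_heis_Gamma_diag] only the divergence of the symbols
    and their quadratic contraction contribute. *)
Lemma ricci_left_invariant x : ricci (left_invariant G) x =
  - (nuN / 2) *: (Om *m H *m Om^T)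
  - (\tr (H *m Om *m (H *m Om)) / 4) *: (heis_mu x *m (heis_mu x)^T).
Proof.
have chE : christoffel (left_invariant G) = heis_Gamma.
  by do 4!apply/funext => ?; exact: christoffel_left_invariant.
apply/matrixP => i j.
rewrite /ricci mxE /riemann chE.
have Gsy k a b y : heis_Gamma k a b y = heis_Gamma k b a y.
  by rewrite /heis_Gamma !mxDE !mxTE; ring.
have -> : \sum_k (partial k (heis_Gamma k j i) x - partial j (heis_Gamma k k i) x +
   \sum_l (heis_Gamma k k l x * heis_Gamma l j i x -
                heis_Gamma k j l x * heis_Gamma l k i x)) =
  \sum_k partial k (heis_Gamma k j i) x
  - \sum_k \sum_l heis_Gamma k j l x * heis_Gamma l k i x.
  rewrite big_split /= sumrB.
  have -> : \sum_k partial j (heis_Gamma k k i) x = 0.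
    have D : is_derive x (delta_mx 0 j) (fun y => \sum_k heis_Gamma k k i y)
        (\sum_k partial j (heis_Gamma k k i) x).
      apply: is_derive_fsum => k; apply: derivableP.
      by case: (is_derive_Gamma x j k k i).
    rewrite -(partialE D); under eq_fun do rewrite sum_heis_Gamma_diag.
    by apply: partialE; exact: is_derive_fcst.
  rewrite subr0; congr (_ + _).
  under eq_bigr do rewrite sumrB.
  rewrite sumrB exchange_big /= big1 ?sub0r // => l _.
  by rewrite -mulr_suml sum_heis_Gamma_diag mul0r.
rewrite sum_partial_Gamma sum_Gamma_Gamma.
have UK : (H *m Om)^T = Om^T *m H by rewrite trmx_mul trmx_inv Gsym.
have E : 2 * ((U^T *m (H *m Om)) i j + (U^T *m (H *m Om)) j i)
  - ((T *m (H *m Om)) i j + (T *m (H *m Om)) j i) = 2 * (Om *m H *m Om^T) i j.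
  rewrite -[(U^T *m (H *m Om)) j i]mxTE -[(T *m (H *m Om)) j i]mxTE.
  rewrite !(trmx_mul T) !(trmx_mul U^T) UK trmxK.
  have -> : T^T = T by rewrite linearD /= trmxK addrC.
  have -> : Om^T = U^T - U by rewrite linearB /= trmxK.
  rewrite !mulmxA !(mulmxDr, mulmxDl, mulmxBr, mulmxBl, mulmxN, mulNmx).
  by rewrite !(mxDE, mxBE, mxNE); ring.
rewrite mxBE !mxZE mulmx_col_row mxTE.
move: E; set a := (U^T *m _) i j + _; set b := (T *m _) i j + _.
set c := (_ *m _) i j.
move=> E; have -> : b = 2 * a - 2 * c by rewrite -E; ring.
by rewrite [_ j i + _]addrC -/a; field.
Qed.

End Metric.
End Heisenberg.

(** * Functions with a given derivative on the half line *)

Section Evolution.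
Variable R : realType.
Implicit Types (f g : R -> R) (t c : R).

(** Continuity at the origin suffices to apply the mean value theorem on [0, t],
    so one-sided derivatives never have to be manipulated. *)
Definition evolves f f' : Prop :=
  (forall t, 0 < t -> is_derive t 1 f (f' t)) /\ f u @[u --> 0^'+] --> f 0.

Lemma evolves_eq f f' g' : (forall t, 0 < t -> f' t = g' t) ->
  evolves f f' -> evolves f g'.
Proof. by move=> e [df cf]; split => // t t0; rewrite -e //; exact: df. Qed.

Lemma evolves_cst c : evolves (fun=> c) (fun=> 0).
Proof. by split=> [t _|]; [exact: is_derive_fcst|exact: cvg_cst]. Qed.

Lemma evolvesD f g f' g' : evolves f f' -> evolves g g' ->
  evolves (fun t => f t + g t) (fun t => f' t + g' t).
Proof.
move=> [df cf] [dg cg]; split=> [t t0|]; last exact: (cvgD cf cg).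
by have := df t t0; have := dg t t0 => ? ?; exact: is_derive_fD.
Qed.

Lemma evolvesM f g f' g' : evolves f f' -> evolves g g' ->
  evolves (fun t => f t * g t) (fun t => f' t * g t + f t * g' t).
Proof.
move=> [df cf] [dg cg]; split=> [t t0|]; last exact: (cvgM cf cg).
by have := df t t0; have := dg t t0 => ? ?; exact: is_derive_fM.
Qed.

Lemma evolves_sum (I : Type) (r : seq I) (f f' : I -> R -> R) :
  (forall i, evolves (f i) (f' i)) ->
  evolves (fun t => \sum_(i <- r) f i t) (fun t => \sum_(i <- r) f' i t).
Proof.
move=> fE; elim: r => [|i r IH].
  under eq_fun do rewrite big_nil.
  by under [X in evolves _ X]eq_fun do rewrite big_nil; exact: evolves_cst.
under eq_fun do rewrite big_cons.
by under [X in evolves _ X]eq_fun do rewrite big_cons; exact: evolvesD.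
Qed.

Lemma evolvesZ c f f' : evolves f f' ->
  evolves (fun t => c * f t) (fun t => c * f' t).
Proof.
move=> fE; apply: evolves_eq (evolvesM (evolves_cst c) fE) => t _ /=.
by rewrite mul0r add0r.
Qed.

Lemma evolvesV f f' : (forall t, 0 <= t -> f t != 0) -> evolves f f' ->
  evolves (fun t => (f t)^-1) (fun t => - (f' t / f t ^+ 2)).
Proof.
move=> f0 [df cf]; split=> [t t0|]; last exact: (cvgV (f0 0 (lexx 0)) cf).
have := df t t0 => dft; apply: is_derive_eq.
  exact: (is_deriveV (f0 t (ltW t0)) dft).
by rewrite /GRing.scale /= mulNr mulrC.
Qed.

Lemma evolvesX f f' n : evolves f f' ->
  evolves (fun t => f t ^+ n.+1) (fun t => n.+1%:R * f t ^+ n * f' t).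
Proof.
move=> fE; elim: n => [|n IH].
  apply: (evolves_eq _ fE) => t _; first by rewrite expr0 !mul1r.
rewrite (_ : (fun t => f t ^+ n.+2) = (fun t => f t * f t ^+ n.+1)); last first.
  by apply/funext => t; rewrite exprS.
apply: evolves_eq (evolvesM fE IH) => t _.
by rewrite [n.+2%:R](natrD R 1 n.+1) exprS; ring.
Qed.

(** Logarithmic differentiation. *)
Lemma evolves_prod (I : Type) (r : seq I) (f f' : I -> R -> R) :
  (forall i t, 0 <= t -> f i t != 0) -> (forall i, evolves (f i) (f' i)) ->
  evolves (fun t => \prod_(i <- r) f i t)
    (fun t => \prod_(i <- r) f i t * \sum_(i <- r) f' i t / f i t).
Proof.
move=> f0 fE; elim: r => [|i r IH].
  under eq_fun do rewrite big_nil.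
  apply: evolves_eq (evolves_cst 1) => t _; by rewrite !big_nil mulr0.
under eq_fun do rewrite big_cons.
apply: evolves_eq (evolvesM (fE i) IH) => t t0.
have := f0 i t (ltW t0) => fit.
by rewrite !big_cons; field.
Qed.

Lemma evolves_ge f f' c : evolves f f' -> (forall t, 0 < t -> c <= f' t) ->
  forall t, 0 <= t -> f 0 + c * t <= f t.
Proof.
move=> [df cf] cf' t; rewrite le_eqVlt => /predU1P[<-|t0].
  by rewrite mulr0 addr0.
have [x xI E] : exists2 x, x \in `]0, t[%R & f t - f 0 = f' x * (t - 0).
  apply: MVT => // [x|].
    by rewrite in_itv /= => /andP[x0 _]; exact: df.
  have cont x : 0 < x -> {for x, continuous f}.
    move=> x0; have [dx _] := df x x0.
    by apply: differentiable_continuous; apply/derivable1_diffP.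
  apply/continuous_within_itvP => //; split=> //.
    by move=> x; rewrite in_itv /= => /andP[x0 _]; exact: cont.
  by apply: cvg_at_left_filter; exact: cont.
rewrite addrC -lerBrDr E subr0 ler_pM2r //; apply: cf'.
by move: xI; rewrite in_itv /= => /andP[].
Qed.

Lemma evolves_le f f' c : evolves f f' -> (forall t, 0 < t -> f' t <= c) ->
  forall t, 0 <= t -> f t <= f 0 + c * t.
Proof.
move=> fE f'c t t0.
have := @evolves_ge _ _ (-1 * c) (evolvesZ (-1) fE) _ t t0.
rewrite -mulrA -mulrDr !mulN1r lerN2; apply=> u u0.
by rewrite !mulN1r lerN2; exact: f'c.
Qed.

Lemma evolves_const f f' : evolves f f' -> (forall t, 0 < t -> f' t = 0) ->
  forall t, 0 <= t -> f t = f 0.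
Proof.
move=> fE f'0 t t0; apply/eqP; rewrite eq_le; apply/andP; split.
  rewrite -[leRHS]addr0 -[X in _ + X](mul0r t); apply: evolves_le fE _ _ t0.
  by move=> u u0; rewrite f'0.
rewrite -[leLHS]addr0 -[X in _ + X](mul0r t); apply: evolves_ge fE _ _ t0.
by move=> u u0; rewrite f'0.
Qed.

(** Two solutions of the same scalar linear equation have a constant ratio. With
    [f 0 = 0] this is the only form of uniqueness for differential equations that
    the preservation of diagonality requires. *)
Lemma evolves_proportional f g (a : R -> R) :
  evolves f (fun t => a t * f t) -> evolves g (fun t => a t * g t) ->
  (forall t, 0 <= t -> g t != 0) ->
  forall t, 0 <= t -> f t = f 0 / g 0 * g t.
Proof.
move=> fE gE g0 t t0; rewrite -[LHS](divfK (g0 t t0)); congr (_ * _).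
apply: (evolves_const (evolvesM fE (evolvesV g0 gE))) t0 => u u0.
by have gu := g0 u (ltW u0); field.
Qed.

End Evolution.

Section MatrixEvolution.
Variable R : realType.

Definition mevolves p q (A A' : R -> 'M[R]_(p, q)) : Prop :=
  forall i j, evolves (fun t => A t i j) (fun t => A' t i j).

Lemma mevolves_cst p q (A : 'M[R]_(p, q)) : mevolves (fun=> A) (fun=> 0).
Proof.
by move=> i j; apply: evolves_eq (evolves_cst (A i j)) => t _; rewrite mxE.
Qed.

Lemma mevolvesM p q r (A A' : R -> 'M[R]_(p, q)) (B B' : R -> 'M[R]_(q, r)) :
  mevolves A A' -> mevolves B B' ->
  mevolves (fun t => A t *m B t) (fun t => A' t *m B t + A t *m B' t).
Proof.
move=> AE BE i j.
have := evolves_sum (index_enum _) (fun k => evolvesM (AE i k) (BE k j)).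
move=> H; under eq_fun do rewrite mxE.
by apply: evolves_eq H => t _; rewrite !mxE big_split.
Qed.

Lemma mevolves_eq p q (A A' B' : R -> 'M[R]_(p, q)) :
  (forall t, 0 < t -> A' t = B' t) -> mevolves A A' -> mevolves A B'.
Proof.
by move=> e AE i j; apply: evolves_eq (AE i j) => t t0; rewrite e.
Qed.

End MatrixEvolution.

(** * Asymptotics of the diagonal system *)

(** The functions [x k] model the geometric means of the metric coefficients of
    the pairs of conjugate directions, and [z] the coefficient of the centre. *)
Section Asymptotics.
Variables (R : realType) (n : nat).
Hypothesis n_gt0 : (0 < n)%N.
Variables (x : 'I_n -> R -> R) (z : R -> R).
Hypothesis x_gt0 : forall k t, 0 <= t -> 0 < x k t.
Hypothesis z_gt0 : forall t, 0 <= t -> 0 < z t.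
Hypothesis xE : forall k, evolves (x k) (fun t => z t / x k t).
Hypothesis zE : evolves z (fun t => - (z t ^+ 2 * \sum_(k < n) (x k t ^+ 2)^-1)).

Let kappa := z 0 * \prod_(k < n) x k 0.
Let A : R := n.+2%:R * kappa.
Let b : R := 1 / n.+2%:R.

Let x_neq0 k t : 0 <= t -> x k t != 0.
Proof. by move=> t0; rewrite gt_eqF // x_gt0. Qed.

Let x_ge0 k t : 0 <= t -> 0 <= x k t.
Proof. by move=> t0; rewrite ltW // x_gt0. Qed.

Let z_ge0 t : 0 <= t -> 0 <= z t.
Proof. by move=> t0; rewrite ltW // z_gt0. Qed.

(** The logarithmic derivatives of [z] and of the product of the [x k] are
    opposite. This first integral eliminates [z]. *)
Lemma diag_invariant t : 0 <= t -> z t * \prod_(k < n) x k t = kappa.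
Proof.
apply: (evolves_const (evolvesM zE
  (evolves_prod (index_enum _) (fun k => @x_neq0 k) xE))) => u u0.
have -> : \sum_(k < n) z u / x k u / x k u = z u * \sum_(k < n) (x k u ^+ 2)^-1.
  by rewrite mulr_sumr; apply: eq_bigr => k _; rewrite expr2 invfM mulrA.
by ring.
Qed.

(** All the squares [x k t ^+ 2] have the same derivative [2 z], so the [x k] keep
    their order and drift apart by a bounded amount. *)
Lemma diag_sqr_diff k l t : 0 <= t ->
  x k t ^+ 2 - x l t ^+ 2 = x k 0 ^+ 2 - x l 0 ^+ 2.
Proof.
move=> t0; rewrite -!(mulN1r (x l _ ^+ 2)).
apply: (evolves_const (evolvesD (evolvesX 1 (xE k))
  (evolvesZ (-1) (evolvesX 1 (xE l))))) t0 => u u0.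
have xk := x_neq0 k (ltW u0); have xl := x_neq0 l (ltW u0).
by field; rewrite xk xl.
Qed.

Lemma diag_order k l t : x l 0 <= x k 0 -> 0 <= t -> x l t <= x k t.
Proof.
move=> lk t0; rewrite -[_ <= _](ler_pXn2r (_ : 0 < 2)%N) ?nnegrE ?x_ge0 //.
rewrite -subr_ge0 (diag_sqr_diff k l t0) subr_ge0.
by rewrite ler_pXn2r ?nnegrE ?x_ge0.
Qed.

Let powE k : evolves (fun t => x k t ^+ n.+2)
  (fun t => n.+2%:R * (z t * x k t ^+ n)).
Proof.
apply: evolves_eq (evolvesX n.+1 (xE k)) => t t0.
by have := x_neq0 k (ltW t0) => xk; rewrite exprS; field.
Qed.

Let kappa_gt0 : 0 < kappa.
Proof.
by rewrite mulr_gt0 ?z_gt0 // prodr_gt0 // => k _; exact: x_gt0.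
Qed.

Let A_gt0 : 0 < A. Proof. by rewrite mulr_gt0. Qed.

(** The derivative of [x k ^+ n.+2] is [n.+2] times [z * x k ^+ n]. For the largest
    [x k] this is at least, and for the smallest one at most, [n.+2] times the first
    integral [z * \prod_l x l], a constant. *)
Lemma diag_max_pow k : (forall l, x l 0 <= x k 0) ->
  forall t, 0 <= t -> A * t <= x k t ^+ n.+2.
Proof.
move=> kmax t t0; apply: le_trans (evolves_ge (c := A) (powE k) _ t0).
  by rewrite lerDr exprn_ge0 // ltW // x_gt0.
move=> u u0; rewrite /A ler_pM2l // -(diag_invariant (ltW u0)).
have -> : x k u ^+ n = \prod_(l < n) x k u by rewrite prodr_const card_ord.
have u0' := ltW u0; rewrite ler_wpM2l ?z_ge0 //; apply: ler_prod => l _.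
by rewrite x_ge0 //= diag_order.
Qed.

Lemma diag_min_pow k : (forall l, x k 0 <= x l 0) ->
  forall t, 0 <= t -> x k t ^+ n.+2 <= x k 0 ^+ n.+2 + A * t.
Proof.
move=> kmin t t0; apply: evolves_le (powE k) _ _ t0 => u u0.
rewrite /A ler_pM2l // -(diag_invariant (ltW u0)).
have -> : x k u ^+ n = \prod_(l < n) x k u by rewrite prodr_const card_ord.
have u0' := ltW u0; rewrite ler_wpM2l ?z_ge0 //; apply: ler_prod => l _.
by rewrite x_ge0 //= diag_order.
Qed.

Lemma diag_gap k l : exists c, forall t, 0 <= t -> x k t - x l t <= c.
Proof.
(* The difference of the squares is constant, and the sum of [x k t] and [x l t] is
   at least [x l 0] because [x l] increases. *)
exists (`|x k 0 ^+ 2 - x l 0 ^+ 2| / x l 0) => t t0.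
rewrite ler_pdivlMr ?x_gt0 //.
have [kl|kl] := leP (x k t) (x l t).
  apply: le_trans (normr_ge0 _); rewrite mulr_le0_ge0 ?subr_le0 ?x_ge0 //.
have kl0 : 0 <= x k t - x l t by rewrite subr_ge0 ltW.
rewrite -(diag_sqr_diff k l t0) subr_sqr normrM (ger0_norm kl0).
apply: ler_wpM2l => //; apply: le_trans (ler_norm _).
apply: ler_wpDl; first exact: x_ge0.
rewrite -[leLHS]addr0 -[X in _ + X](mul0r t).
apply: evolves_ge (xE l) _ _ t0 => u u0.
by rewrite divr_ge0 ?z_ge0 ?x_ge0 // ltW.
Qed.

Let b_gt0 : 0 < b. Proof. by rewrite divr_gt0. Qed.

Let powbK (y : R) : 0 <= y -> (y ^+ n.+2) `^ b = y.
Proof.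
by move=> y0; rewrite -powR_mulrn // -powRrM /b mul1r mulfV ?powRr1.
Qed.

Let ler_powb (y w : R) : 0 <= y -> y <= w -> y `^ b <= w `^ b.
Proof.
move=> y0 yw; apply: ge0_ler_powR; rewrite ?nnegrE //; first exact: ltW.
exact: le_trans yw.
Qed.

Lemma diag_bounds : exists B c, [/\ 0 <= B & forall k t, 0 <= t ->
  (A * t) `^ b - c <= x k t <= (A * t + B) `^ b + c].
Proof.
pose i0 : 'I_n := Ordinal n_gt0.
have [M Mmax] : exists M, forall l, x l 0 <= x M 0.
  by exists [arg max_(i > i0) x i 0]%O; case: arg_maxP => // i _ H l; exact: H.
have [m mmin] : exists m, forall l, x m 0 <= x l 0.
  by exists [arg min_(i < i0) x i 0]%O; case: arg_minP => // i _ H l; exact: H.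
have [c Hc] := diag_gap M m.
exists (x m 0 ^+ n.+2), c; split; first by rewrite exprn_ge0 ?x_ge0.
move=> k t t0.
have At0 : 0 <= A * t by rewrite mulr_ge0 // ltW.
have hM : (A * t) `^ b <= x M t.
  by rewrite -[leRHS]powbK ?x_ge0 // ler_powb // diag_max_pow.
have hm : x m t <= (A * t + x m 0 ^+ n.+2) `^ b.
  rewrite -[leLHS]powbK ?x_ge0 // ler_powb ?exprn_ge0 ?x_ge0 //.
  by rewrite addrC diag_min_pow.
have := Hc t t0.
have := diag_order (Mmax k) t0; have := diag_order (mmin k) t0.
by move=> mk kM cc; apply/andP; split; lra.
Qed.

Lemma cvg_powb_pinfty : t `^ b @[t --> +oo] --> +oo.
Proof.
apply/cvgryPge => C; near=> t.
have H : `|C| ^+ n.+2 <= t by near: t; exact: nbhs_pinfty_ge.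
by rewrite (le_trans (ler_norm C)) // -[leLHS]powbK // ler_powb // exprn_ge0.
Unshelve. all: by end_near. Qed.

Lemma powb_cont (a : R) : 0 < a -> {for a, continuous (fun y : R => y `^ b)}.
Proof.
move=> a0; have [dx _] := is_derive1_powR b a0.
by apply: differentiable_continuous; apply/derivable1_diffP.
Qed.

(** Every [x k] is squeezed between the extreme ones up to a bounded error. *)
Lemma diag_asymp k : x k t / t `^ b @[t --> +oo] --> A `^ b.
Proof.
have [B [c [B0 bnd]]] := diag_bounds.
have inv0 (f : R -> R) : f t @[t --> +oo] --> +oo -> (f t)^-1 @[t --> +oo] --> 0.
  move=> fy; apply/gtr0_cvgV0 => //.
  by have /cvgryPgt/(_ 0) := fy.
have powV := inv0 _ cvg_powb_pinfty.
have idV : t^-1 @[t --> +oo] --> (0 : R) by exact: inv0 cvg_id.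
have cV : c * (t `^ b)^-1 @[t --> +oo] --> 0.
  by rewrite -(mulr0 c); apply: cvgM; [exact: cvg_cst|exact: powV].
apply: (@squeeze_cvgr _ _ _ _ (fun t => A `^ b - c * (t `^ b)^-1)
  (fun t => (A + B * t^-1) `^ b + c * (t `^ b)^-1)).
- near=> t; have t0 : 0 < t by near: t; exact: nbhs_pinfty_gt.
  have tb : 0 < t `^ b by exact: powR_gt0.
  have /andP[lo hi] := bnd k t (ltW t0).
  rewrite ler_pdivlMr // ler_pdivrMr // mulrBl mulrDl mulfVK ?gt_eqF //.
  have [t0' A0'] := (ltW t0, ltW A_gt0).
  have AB0 : 0 <= A + B * t^-1.
    by apply: addr_ge0 => //; apply: mulr_ge0 => //; rewrite invr_ge0.
  rewrite -!powRM //.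
  by rewrite mulrDl mulfVK ?gt_eqF // lo.
- have h : A `^ b - c * (t `^ b)^-1 @[t --> +oo] --> A `^ b - 0.
    by apply: cvgB; [exact: cvg_cst|exact: cV].
  by rewrite subr0 in h.
- have h : A + B * t^-1 @[t --> +oo] --> A + B * 0.
    apply: cvgD; first exact: cvg_cst.
    by apply: cvgM; [exact: cvg_cst|exact: idV].
  rewrite mulr0 addr0 in h.
  have h' : (A + B * t^-1) `^ b + c * (t `^ b)^-1 @[t --> +oo] --> A `^ b + 0.
    apply: cvgD; last exact: cV.
    exact: (continuous_cvg _ (powb_cont A_gt0) h).
  by rewrite addr0 in h'.
Unshelve. all: by end_near. Qed.

Lemma cvg_prod (I : Type) (r : seq I) (f : I -> R -> R) (l : I -> R)
    (F : set_system R) :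
  Filter F -> (forall i, f i t @[t --> F] --> l i) ->
  \prod_(i <- r) f i t @[t --> F] --> \prod_(i <- r) l i.
Proof.
move=> FF fl; elim: r => [|i r IH].
  by under eq_fun do rewrite big_nil; rewrite big_nil; exact: cvg_cst.
by under eq_fun do rewrite big_cons; rewrite big_cons; exact: cvgM.
Qed.

Lemma diag_asympN :
  z t / t `^ (- (n%:R / n.+2%:R)) @[t --> +oo] -->
  kappa * A `^ (- (n%:R / n.+2%:R)).
Proof.
have powE' (a : R) : a `^ (- (n%:R / n.+2%:R)) = ((a `^ b) ^+ n)^-1.
  rewrite powRN -powR_mulrn ?powR_ge0 // -powRrM; congr (_ `^ _)^-1.
  by rewrite /b mul1r mulrC.
have H : kappa * (\prod_(k < n) (x k t / t `^ b))^-1 @[t --> +oo] -->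
    kappa * (\prod_(k < n) A `^ b)^-1.
  apply: cvgM; first exact: cvg_cst.
  apply: cvgV; first by apply/prodf_neq0 => k _; rewrite gt_eqF // powR_gt0.
  exact: (cvg_prod _ diag_asymp).
rewrite powE'; rewrite prodr_const card_ord in H.
apply: cvg_trans H; apply: near_eq_cvg; near=> t.
have t0 : 0 < t by near: t; exact: nbhs_pinfty_gt.
rewrite powE' invrK big_split /= prodr_const card_ord exprVn.
rewrite -(diag_invariant (ltW t0)).
have : \prod_(k < n) x k t != 0 by apply/prodf_neq0 => k _; rewrite x_neq0 ?ltW.
have : (t `^ b) ^+ n != 0 by rewrite expf_neq0 // gt_eqF // powR_gt0.
by move=> ? ?; field; apply/andP.
Unshelve. all: by end_near. Qed.

End Asymptotics.

(** * Left-invariant Ricci flows *)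

Section DifferenceQuotients.
Variable R : realType.
Implicit Types (f : R -> R) (t l : R).

Lemma quotient_is_derive f t l (I : set R) : nbhs t I ->
  (f u - f t) / (u - t) @[u --> within I t^'] --> l -> is_derive t 1 f l.
Proof.
move=> It /cvgrPdist_lt Hq.
have H : h^-1 *: ((f \o shift t) (h *: 1) - f t) @[h --> 0^'] --> l.
  apply/cvgrPdist_lt => e e0; have := Hq e e0.
  move=> H; have {}H : \forall u \near t^',
    I u -> `|l - (f u - f t) / (u - t)| < e := H.
  have H' : \forall u \near t^', I u by exact: cvg_within It.
  have {H'}H : \forall u \near t^', `|l - (f u - f t) / (u - t)| < e.
    by apply: filterS2 H H' => u; exact.
  have /nbhs_ballP[d /= d0 Hd] :
      nbhs t (fun u => u != t -> `|l - (f u - f t) / (u - t)| < e).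
    exact: H.
  apply/nbhs_ballP; exists d => //= h; rewrite /ball /= sub0r normrN => hd h0.
  have := Hd (h + t); rewrite /ball /= opprD addrCA subrr addr0 normrN.
  move=> /(_ hd); rewrite -subr_eq0 addrK => /(_ h0).
  by rewrite /GRing.scale /= mulr1 mulrC.
split; first by apply/cvg_ex; exists l.
exact: cvg_lim H.
Qed.

Lemma is_derive_quotient f t l (I : set R) : is_derive t 1 f l ->
  (f u - f t) / (u - t) @[u --> within I t^'] --> l.
Proof.
move=> [df fl].
have H : h^-1 *: ((f \o shift t) (h *: 1) - f t) @[h --> 0^'] --> l.
  by rewrite -fl; exact: df.
apply: cvg_within_filter.
move/cvgrPdist_lt : H => Hq; apply/cvgrPdist_lt => e e0.
have /nbhs_ballP[d /= d0 Hd] := Hq e e0.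
apply/nbhs_ballP; exists d => //= u; rewrite /ball /= => ud ut.
have := Hd (u - t); rewrite /ball /= sub0r normrN -normrN opprB => /(_ ud).
rewrite subr_eq0 => /(_ ut).
by rewrite /GRing.scale /= mulr1 subrK mulrC.
Qed.

(** At the origin the difference quotients are one-sided; only the continuity that
    their convergence entails is kept. *)
Lemma quotient_evolves f f' :
  (forall t, 0 <= t ->
    (f u - f t) / (u - t) @[u --> within `[0, +oo[ t^'] --> f' t) ->
  evolves f f'.
Proof.
move=> H; split=> [t t0|].
  apply: quotient_is_derive (H t (ltW t0)).
  near=> u; rewrite /= in_itv /= andbT ltW //.
  by near: u; exact: lt_nbhsr.
have q : (f u - f 0) / (u - 0) @[u --> 0^'+] --> f' 0.
  apply: cvg_trans (H 0 (lexx 0)) => A.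
  move=> hA; have {}hA : nbhs 0 (fun u : R => u != 0 -> `[0, +oo[%classic u ->
    A ((f u - f 0) / (u - 0))) := hA.
  have : nbhs 0 (fun u : R => 0 < u -> A ((f u - f 0) / (u - 0))).
    apply: filterS hA => u hA u0; apply: hA; first by rewrite gt_eqF.
    by rewrite /= in_itv /= andbT ltW.
  exact.
have H0 : f 0 + (f u - f 0) / (u - 0) * u @[u --> 0^'+] --> f 0 + f' 0 * 0.
  apply: cvgD; first exact: cvg_cst.
  by apply: cvgM => //; exact: cvg_at_right_filter.
rewrite mulr0 addr0 in H0.
apply: cvg_trans H0; apply: near_eq_cvg; near=> u.
have u0 : 0 < u by near: u; exact: nbhs_right_gt.
by rewrite subr0 mulfVK ?gt_eqF // addrC subrK.
Unshelve. all: by end_near. Qed.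

End DifferenceQuotients.

Section InnerProduct.
Variables (R : realType) (m : nat).
Implicit Type G : 'M[R]_m.

Lemma inner_product_unit G : inner_product G -> G \in unitmx.
Proof.
move=> [_ Gpos]; rewrite -row_free_unit -kermx_eq0; apply/eqP/row_matrixP => i.
rewrite row0; apply/eqP; apply/negPn/negP => ker0.
have := Gpos _ ker0; rewrite -row_mul mulmx_ker row0 mul0mx mxE.
by rewrite ltxx.
Qed.

Lemma inner_product_gt0 G i : inner_product G -> 0 < G i i.
Proof.
move=> [_ Gpos]; have := Gpos (delta_mx 0 i).
rewrite -rowE trmx_delta -colE !mxE; apply.
apply/negP => /eqP/matrixP/(_ 0 i); rewrite !mxE !eqxx => /eqP.
by rewrite oner_eq0.
Qed.

End InnerProduct.

Section HeisenbergAction.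
Variables (R : realType) (n : nat).
Local Notation M := 'M[R]_(n + n + 1).
Local Notation N := (iN n).
Local Notation Om := (heis_bracket R n).
Local Notation eN := (eN R n).

Lemma row_heisU (i : 'I_(n + n + 1)) :
  row i (heis_pairing R n) = \sum_(k < n) (i == ia k)%:R *: delta_mx 0 (ib k).
Proof.
rewrite rowE /heis_pairing mulmx_sumr; apply: eq_bigr => k _.
have [->|ik] := eqVneq i (ia k); first by rewrite mul_delta_mx scale1r.
by rewrite mul_delta_mx_0 // scale0r.
Qed.

Lemma row_heisUT (i : 'I_(n + n + 1)) :
  row i (heis_pairing R n)^T = \sum_(k < n) (i == ib k)%:R *: delta_mx 0 (ia k).
Proof.
rewrite rowE /heis_pairing linear_sum mulmx_sumr; apply: eq_bigr => k _.
rewrite /= trmx_delta; have [->|ik] := eqVneq i (ib k).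
  by rewrite mul_delta_mx scale1r.
by rewrite mul_delta_mx_0 // scale0r.
Qed.

Lemma row_heisO_ia (k : 'I_n) : row (ia k) Om = delta_mx 0 (ib k).
Proof.
rewrite linearB /= row_heisU row_heisUT (bigD1 k) //= eqxx scale1r.
rewrite !big1 ?addr0 ?subr0 // => l; first by rewrite ia_neq_ib scale0r.
by rewrite eq_ia eq_sym => /negbTE ->; rewrite scale0r.
Qed.

Lemma row_heisO_ib (k : 'I_n) : row (ib k) Om = - delta_mx 0 (ia k).
Proof.
rewrite linearB /= row_heisU row_heisUT [X in _ - X](bigD1 k) //= eqxx scale1r.
rewrite !big1 ?addr0 ?sub0r // => l.
  by rewrite eq_ib eq_sym => /negbTE ->; rewrite scale0r.
by rewrite eq_sym ia_neq_ib scale0r.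
Qed.

Lemma row_heisO_iN : row N Om = 0.
Proof. by rewrite rowE -trmx_delta eNT_heisO. Qed.

(** Across the centre the bracket form is a signed permutation matrix exchanging
    conjugate directions, so conjugation by it permutes the entries up to sign. *)
Lemma heisO_conjE (A : M) i j :
  (Om *m A *m Om^T) i j = (row i Om *m A *m (row j Om)^T) 0 0.
Proof. by rewrite tr_row colE mulmxA -colE -!row_mul !mxE. Qed.

Let delta_conj (A : M) (i j : 'I_(n + n + 1)) :
  (delta_mx 0 i *m A *m (delta_mx 0 j)^T) (0 : 'I_1) (0 : 'I_1) = A i j.
Proof. by rewrite -rowE trmx_delta -colE !mxE. Qed.

Lemma heisO_conj_ia (A : M) (k l : 'I_n) :
  (Om *m A *m Om^T) (ia k) (ia l) = A (ib k) (ib l).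
Proof. by rewrite heisO_conjE !row_heisO_ia delta_conj. Qed.

Lemma heisO_conj_ib (A : M) (k l : 'I_n) :
  (Om *m A *m Om^T) (ib k) (ib l) = A (ia k) (ia l).
Proof.
rewrite heisO_conjE !row_heisO_ib linearN /= mulmxN !mulNmx opprK.
exact: delta_conj.
Qed.

Lemma heisO_conj_ab (A : M) (k l : 'I_n) :
  (Om *m A *m Om^T) (ia k) (ib l) = - A (ib k) (ia l).
Proof.
rewrite heisO_conjE row_heisO_ia row_heisO_ib linearN /= mulmxN mxE.
by rewrite delta_conj.
Qed.

Lemma heisO_conj_ba (A : M) (k l : 'I_n) :
  (Om *m A *m Om^T) (ib k) (ia l) = - A (ia k) (ib l).
Proof.
rewrite heisO_conjE row_heisO_ia row_heisO_ib !mulNmx mxE.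
by rewrite delta_conj.
Qed.

Lemma heisO_conj_Nl (A : M) j : (Om *m A *m Om^T) N j = 0.
Proof. by rewrite heisO_conjE row_heisO_iN !mul0mx mxE. Qed.

Lemma heisO_conj_Nr (A : M) i : (Om *m A *m Om^T) i N = 0.
Proof. by rewrite heisO_conjE row_heisO_iN trmx0 mulmx0 mxE. Qed.

Lemma heisO_conj_diag (A : M) : is_diag_mx A -> is_diag_mx (Om *m A *m Om^T).
Proof.
move=> /is_diag_mxP diagA; apply/is_diag_mxP => i j; rewrite val_eqE => ij.
have dA (a b : 'I_(n + n + 1)) : a != b -> A a b = 0.
  by move=> ab; apply: diagA; rewrite val_eqE.
move: (heis_indexP i) (heis_indexP j) ij.
move=> [[k ->]|[k ->]|->] [[l ->]|[l ->]|->] ij;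
  rewrite ?heisO_conj_Nl ?heisO_conj_Nr // ?heisO_conj_ia ?heisO_conj_ib
    ?heisO_conj_ab ?heisO_conj_ba dA ?oppr0 // 1?[ib _ == _]eq_sym ?ia_neq_ib //.
- by rewrite eq_ib eq_sym -eq_ia.
- by rewrite eq_ia -eq_ib.
Qed.

End HeisenbergAction.

Section HeisenbergFlow.
Variables (R : realType) (n : nat).
Local Notation M := 'M[R]_(n + n + 1).
Local Notation N := (iN n).
Local Notation Om := (heis_bracket R n).
Local Notation eN := (eN R n).

Lemma coframe0 : coframe (0 : heis R n) = 1%:M.
Proof. by rewrite coframeE !mul0mx mulmx0 subr0. Qed.

Lemma left_invariant0 (G : M) : left_invariant G 0 = G.
Proof. by rewrite /left_invariant coframe0 trmx1 mul1mx mulmx1. Qed.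

Lemma eNE (i j : 'I_(n + n + 1)) : (eN *m eN^T) i j = ((i == N) && (j == N))%:R.
Proof. by rewrite trmx_delta mul_delta_mx mxE. Qed.

Let scale_rank_oneE (A : M) (u v : 'cV[R]_(n + n + 1)) a b i j :
  (a *: A + b *: (u *m v^T)) i j = a * A i j + b * (u i 0 * v j 0).
Proof. by rewrite !mxE big_ord1 mxE. Qed.

Lemma mxtrace_heisO_diag (G : M) : G \in unitmx -> is_diag_mx G ->
  \tr (invmx G *m Om *m (invmx G *m Om)) =
  - (2 * \sum_(k < n) (G (ia k) (ia k) * G (ib k) (ib k))^-1).
Proof.
move=> Gu /is_diag_mxP dG.
have HE i j : invmx G i j * G j j = (i == j)%:R.
  have /matrixP/(_ i j) := mulVmx Gu; rewrite mxE (bigD1 j) //= big1 ?addr0.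
    by move=> ->; rewrite mxE.
  by move=> k kj; rewrite dG ?mulr0.
have G0 i : G i i != 0.
  have := HE i i; rewrite eqxx => H; apply/eqP => g0; move: H.
  by rewrite g0 mulr0 => /eqP; rewrite eq_sym oner_eq0.
have Hd i : invmx G i i = (G i i)^-1.
  by rewrite -[LHS](mulfK (G0 i)) HE eqxx mul1r.
have Hoff i j : i != j -> invmx G i j = 0.
  move=> ij; apply: (mulIf (G0 j)).
  by rewrite HE (negbTE ij) mul0r.
have -> : invmx G *m Om *m (invmx G *m Om) =
    - (invmx G *m (Om *m invmx G *m Om^T)).
  by rewrite heisOT !mulmxN opprK !mulmxA.
have trN (B : M) : \tr (- B) = - \tr B by exact: raddfN.
rewrite trN; congr (- _).
have E i : (invmx G *m (Om *m invmx G *m Om^T)) i i =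
    (G i i)^-1 * (Om *m invmx G *m Om^T) i i.
  rewrite mxE (bigD1 i) //= Hd big1 ?addr0 // => j ji.
  by rewrite Hoff ?mul0r // eq_sym.
rewrite /mxtrace; under eq_bigr do rewrite E.
rewrite !big_split_ord /= big_ord1 heisO_conj_Nl mulr0 addr0.
rewrite -big_split mulr_sumr; apply: eq_bigr => k _ /=.
rewrite -!/(ia k) -!/(ib k) heisO_conj_ia heisO_conj_ib !Hd invfM.
by ring.
Qed.

Variable g : R -> M.
Hypothesis flow : ricci_flow `[0, +oo[ (fun t => left_invariant (g t)).

Let It (t : R) : 0 <= t -> `[0, +oo[%classic t.
Proof. by move=> t0; rewrite /= in_itv /= t0. Qed.

Lemma flow_inner t : 0 <= t -> inner_product (g t).
Proof.
move=> /It/flow[[_ /(_ 0) +] _].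
by rewrite left_invariant0.
Qed.

Let gunit t : 0 <= t -> g t \in unitmx.
Proof. by move=> /flow_inner/inner_product_unit. Qed.

Let gsym t : 0 <= t -> (g t)^T = g t.
Proof. by move=> /flow_inner[]. Qed.

Let ggt0 t i : 0 <= t -> 0 < g t i i.
Proof. by move=> /flow_inner/inner_product_gt0. Qed.

Let lam t := \tr (invmx (g t) *m Om *m (invmx (g t) *m Om)) / 2.

(** Evaluating the flow equation at the identity of the group loses nothing, since
    both sides are left-invariant. *)
Lemma flow_evolves : mevolves g (fun t =>
  g t N N *: (Om *m invmx (g t) *m Om^T)
  + lam t *: (g t *m eN *m (g t *m eN)^T)).
Proof.
move=> i j.
apply: (@quotient_evolves _ (fun t => g t i j)) => t t0.
have E : - 2 * ricci (left_invariant (g t)) 0 i j =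
    (g t N N *: (Om *m invmx (g t) *m Om^T)
     + lam t *: (g t *m eN *m (g t *m eN)^T)) i j.
  rewrite (ricci_left_invariant (gsym t0) (gunit t0)) /heis_mu coframe0 trmx1.
  by rewrite mul1mx -[- ((_ / 4) *: _)]scaleNr !scale_rank_oneE /lam; field.
have [_ /(_ 0 i j)] := flow (It t0); rewrite E.
by under eq_fun do rewrite !left_invariant0.
Qed.

Lemma flow_evolvesN i : evolves (fun t => g t i N)
  (fun t => (lam t * g t N N) * g t i N).
Proof.
apply: evolves_eq (flow_evolves i N) => t t0.
rewrite scale_rank_oneE heisO_conj_Nr mulr0 add0r -!colE ![col _ _ _ _]mxE.
by ring.
Qed.

Hypothesis diag0 : is_diag_mx (g 0).

Let off0 i j : i != j -> g 0 i j = 0.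
Proof. by move/is_diag_mxP: diag0 => d ij; apply: d. Qed.

Let gneq0 t i : 0 <= t -> g t i i != 0.
Proof. by move=> t0; rewrite gt_eqF // ggt0. Qed.

(** The last column of the metric satisfies a linear equation with the same scalar
    coefficient for all of its entries. *)
Lemma flow_offN i t : i != N -> 0 <= t -> g t i N = 0.
Proof.
move=> neN t0.
have gN0 u (u0 : 0 <= u) := gneq0 N u0.
rewrite (evolves_proportional (flow_evolvesN i) (flow_evolvesN N) gN0 t0).
by rewrite off0 // mul0r mul0r.
Qed.

Lemma flow_eN t : 0 <= t -> g t *m eN = g t N N *: eN.
Proof.
move=> t0; apply/colP => i; rewrite -colE !mxE eqxx andbT.
have [->|neN] := eqVneq i N; first by rewrite mulr1.
by rewrite (flow_offN neN t0) mulr0n mulr0.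
Qed.

Local Notation Pi := (1%:M - eN *m eN^T : M).

Let PiO : Pi *m Om = Om.
Proof. by rewrite mulmxBl mul1mx -mulmxA eNT_heisO mulmx0 subr0. Qed.

Let OPi : Om *m Pi = Om.
Proof. by rewrite mulmxBr mulmx1 mulmxA heisO_eN mul0mx subr0. Qed.

Let OO : Om *m Om = - Pi.
Proof. by rewrite -heisOOT heisOT mulmxN opprK. Qed.

Let OTeN : Om^T *m eN = 0.
Proof. by rewrite heisOT mulNmx heisO_eN oppr0. Qed.

Let gPi t : 0 <= t -> g t *m Pi = Pi *m g t.
Proof.
move=> t0; have E : eN^T *m g t = g t N N *: eN^T.
  by rewrite -{1}(gsym t0) -trmx_mul flow_eN // linearZ.
rewrite mulmxBr mulmxBl mulmx1 mul1mx mulmxA flow_eN // -mulmxA E.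
by rewrite -scalemxAl -scalemxAr.
Qed.

Let HPi t : 0 <= t -> invmx (g t) *m Pi = Pi *m invmx (g t).
Proof.
move=> t0; have gu := gunit t0.
by rewrite -[LHS](mulmxK gu) -(mulmxA (invmx (g t)) Pi) -gPi // mulKmx.
Qed.

(** For a diagonal metric this is the diagonal matrix of the products of the
    coefficients of conjugate directions. *)
Definition flowS t := Om *m g t *m Om^T *m g t.

(** The inverse metric cancels from this derivative: across the centre the metric
    evolves by [g t N N] times the conjugate of its inverse by the bracket form, and
    this conjugation is an involution there. Hence the off-diagonal entries of
    [flowS] are conserved. *)
Lemma flowS_evolves : mevolves flowS (fun t => (2 * g t N N) *: Pi).
Proof.
have PiT : Pi^T = Pi by rewrite linearB /= trmx1 trmx_mul trmxK.
have PiPi : Pi *m Pi = Pi by rewrite -{2}heisOOT mulmxA PiO heisOOT.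
have OTOT : Om^T *m Om^T = - Pi by rewrite -trmx_mul OO linearN /= PiT.
have OTO : Om^T *m Om = Pi by rewrite heisOT mulNmx OO opprK.
pose G' t := g t N N *: (Om *m invmx (g t) *m Om^T)
  + lam t *: (g t *m eN *m (g t *m eN)^T).
have E1 t : 0 <= t -> Om *m G' t *m Om^T *m g t = g t N N *: Pi.
  move=> t0; rewrite /G' flow_eN // mulmxDr mulmxDl mulmxDl.
  rewrite -!(scalemxAr, scalemxAl) [Om *m (eN *m _)]mulmxA heisO_eN.
  rewrite !mul0mx !scaler0 addr0 !mulmxA OO -(mulmxA _ Om^T Om^T) OTOT.
  rewrite mulmxN !mulNmx opprK -(mulmxA _ Pi) -gPi // mulmxA.
  by rewrite -(mulmxA Pi) mulVmx ?gunit // mulmx1 PiPi.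
have E2 t : 0 <= t -> Om *m g t *m Om^T *m G' t = g t N N *: Pi.
  move=> t0; rewrite /G' flow_eN // mulmxDr.
  rewrite -!(scalemxAr, scalemxAl) [_ *m (eN *m _)]mulmxA.
  rewrite -(mulmxA _ Om^T eN) OTeN mulmx0 mul0mx !scaler0 addr0.
  rewrite !mulmxA -(mulmxA _ Om^T Om) OTO -(mulmxA Om) gPi // mulmxA OPi.
  by rewrite -(mulmxA Om) mulmxV ?gunit // mulmx1 heisOOT.
have C := @mevolves_cst R.
have := mevolvesM (mevolvesM (mevolvesM (C _ _ Om) flow_evolves)
  (C _ _ Om^T)) flow_evolves.
apply: mevolves_eq => t /ltW t0; rewrite -/(G' t).
rewrite mul0mx add0r mulmx0 addr0 E1 // E2 //.
by rewrite -scalerDl -mulr2n mulr_natl.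
Qed.

Lemma flowS_off i j t : i != j -> 0 <= t -> flowS t i j = 0.
Proof.
move=> ij t0.
have -> := evolves_const (flowS_evolves i j) _ t0; last first.
  move=> u u0; rewrite mxE [X in _ * X]mxE [X in _ + X]mxE eNE mxE (negbTE ij).
  have [iE|] := eqVneq i N; last by rewrite subr0 mulr0.
  by rewrite -iE eq_sym (negbTE ij) subr0 mulr0.
have /is_diag_mxP dO := heisO_conj_diag diag0.
rewrite mxE big1 // => k _.
have [ik|ik] := eqVneq i k; last by rewrite dO ?mul0r // val_eqE.
by rewrite off0 ?mulr0 // -ik.
Qed.

Lemma flow_conjS t : 0 <= t ->
  (Om *m invmx (g t) *m Om^T) *m flowS t = Pi *m g t.
Proof.
move=> t0; have OTO : Om^T *m Om = Pi by rewrite heisOT mulNmx OO opprK.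
rewrite /flowS !mulmxA -(mulmxA _ Om^T Om) OTO -(mulmxA Om) HPi // !mulmxA OPi.
by rewrite -(mulmxA Om) mulVmx ?gunit // mulmx1 heisOOT.
Qed.

Lemma flow_conj_entry i j t : i != N -> 0 <= t ->
  (Om *m invmx (g t) *m Om^T) i j * flowS t j j = g t i j.
Proof.
move=> neN t0; have /matrixP/(_ i j) := flow_conjS t0.
rewrite [LHS]mxE (bigD1 j) //= big1 ?addr0; last first.
  by move=> k kj; rewrite flowS_off ?mulr0.
move=> ->; rewrite mulmxBl mul1mx mxE [X in _ + X]mxE -mulmxA.
by rewrite [X in _ - X]mxE big_ord1 mxE (negbTE neN) mul0r subr0.
Qed.

(** As [flowS] is diagonal, [flow_conjS] turns the evolution of a column of the
    metric across the centre into a linear equation with one scalar coefficient for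
    the whole column, as for the last column. *)
Lemma flow_diag t : 0 <= t -> is_diag_mx (g t).
Proof.
move=> t0; apply/is_diag_mxP => i j; rewrite val_eqE => ij.
have [jE|jN] := eqVneq j N; first by rewrite jE flow_offN // -jE.
have [iE|neN] := eqVneq i N.
  by rewrite -(gsym t0) mxE iE flow_offN.
have S0 u : 0 <= u -> flowS u j j != 0.
  move=> u0; apply/eqP => S0; have := flow_conj_entry j jN u0.
  by rewrite S0 mulr0 => /esym/eqP; rewrite (negbTE (gneq0 j u0)).
pose a u := g u N N / flowS u j j.
have E k : k != N -> evolves (fun u => g u k j) (fun u => a u * g u k j).
  move=> kN; apply: evolves_eq (flow_evolves k j) => u /ltW u0.
  rewrite scale_rank_oneE -!colE ![col _ _ _ _]mxE (flow_offN kN u0).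
  rewrite mul0r mulr0 addr0.
  rewrite -(flow_conj_entry j kN u0) /a; move: (_ k j) => y.
  by have := S0 u u0 => Su; field.
rewrite (evolves_proportional (E i neN) (E j jN)
  (fun u u0 => gneq0 j u0)) //.
by rewrite off0 // !mul0r.
Qed.

Let diag_off t i j : 0 <= t -> i != j -> g t i j = 0.
Proof. by move=> /flow_diag/is_diag_mxP d ij; apply: d. Qed.

Let conj_diag t i : 0 <= t -> i != N ->
  (Om *m invmx (g t) *m Om^T) i i = g t i i / flowS t i i.
Proof.
move=> t0 neN; have := flow_conj_entry i neN t0.
move=> E; rewrite -E mulfK //; apply/eqP => S0.
by move: E; rewrite S0 mulr0 => /esym/eqP; rewrite (negbTE (gneq0 i t0)).
Qed.

Lemma flowS_ia t k : 0 <= t ->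
  flowS t (ia k) (ia k) = g t (ib k) (ib k) * g t (ia k) (ia k).
Proof.
move=> t0; rewrite /flowS mxE (bigD1 (ia k)) //= heisO_conj_ia big1 ?addr0 //.
by move=> j jk; rewrite [X in _ * X]diag_off // mulr0.
Qed.

Lemma flowS_ib t k : 0 <= t ->
  flowS t (ib k) (ib k) = g t (ia k) (ia k) * g t (ib k) (ib k).
Proof.
move=> t0; rewrite /flowS mxE (bigD1 (ib k)) //= heisO_conj_ib big1 ?addr0 //.
by move=> j jk; rewrite [X in _ * X]diag_off // mulr0.
Qed.

Let flow_offN_ia t k : 0 <= t -> g t (ia k) N = 0.
Proof. by move=> t0; rewrite flow_offN ?ia_neqN. Qed.

Let flow_offN_ib t k : 0 <= t -> g t (ib k) N = 0.
Proof. by move=> t0; rewrite flow_offN ?ib_neqN. Qed.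

Lemma flow_evolves_ia k : evolves (fun t => g t (ia k) (ia k))
  (fun t => g t N N / g t (ib k) (ib k)).
Proof.
apply: evolves_eq (flow_evolves (ia k) (ia k)) => t /ltW t0.
rewrite scale_rank_oneE -!colE ![col _ _ _ _]mxE flow_offN_ia //.
rewrite mul0r mulr0 addr0 conj_diag ?ia_neqN // flowS_ia // invfM.
by rewrite [_^-1 * _]mulrC mulVKf // gneq0.
Qed.

Lemma flow_evolves_ib k : evolves (fun t => g t (ib k) (ib k))
  (fun t => g t N N / g t (ia k) (ia k)).
Proof.
apply: evolves_eq (flow_evolves (ib k) (ib k)) => t /ltW t0.
rewrite scale_rank_oneE -!colE ![col _ _ _ _]mxE flow_offN_ib //.
rewrite mul0r mulr0 addr0 conj_diag ?ib_neqN // flowS_ib // invfM.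
by rewrite [_^-1 * _]mulrC mulVKf // gneq0.
Qed.

Lemma flow_evolves_iN : evolves (fun t => g t N N)
  (fun t => - (g t N N ^+ 2 *
     \sum_(k < n) (g t (ia k) (ia k) * g t (ib k) (ib k))^-1)).
Proof.
apply: evolves_eq (flow_evolvesN N) => t /ltW t0.
rewrite /lam mxtrace_heisO_diag ?gunit ?flow_diag //.
by field.
Qed.

End HeisenbergFlow.

(** * Asymptotics of Ricci flows starting at a diagonal metric *)

Section FlowAsymptotics.
Variables (R : realType) (n : nat).
Hypothesis n_gt0 : (0 < n)%N.
Local Notation M := 'M[R]_(n + n + 1).
Local Notation N := (iN n).
Local Notation Om := (heis_bracket R n).
Local Notation b := (1 / n.+2%:R : R).
Implicit Type G : M.

(** The geometric mean of the coefficients of a direction and of its conjugate. *)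
Definition heis_mean G i := Num.sqrt ((Om *m G *m Om^T) i i * G i i).

(** The value of the first integral of [diag_invariant]. *)
Definition heis_kappa G := G N N * \prod_(k < n) heis_mean G (ia k).

(** The common limit of the geometric means of all the conjugate pairs, divided by
    [t `^ (1 / n.+2%:R)]. *)
Definition heis_rate G := (n.+2%:R * heis_kappa G) `^ b.

Definition heis_gamma G i : R :=
  if i == N then heis_kappa G * (n.+2%:R * heis_kappa G) `^ (- (n%:R / n.+2%:R))
  else G i i / heis_mean G i * heis_rate G.

Lemma heis_mean_ia G k :
  heis_mean G (ia k) = Num.sqrt (G (ib k) (ib k) * G (ia k) (ia k)).
Proof. by rewrite /heis_mean heisO_conj_ia. Qed.

Lemma heis_mean_ib G k : heis_mean G (ib k) = heis_mean G (ia k).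
Proof. by rewrite heis_mean_ia /heis_mean heisO_conj_ib mulrC. Qed.

Section PositiveDiagonal.
Variable G : M.
Hypothesis Ggt0 : forall i, 0 < G i i.

Lemma heis_mean_gt0 k : 0 < heis_mean G (ia k).
Proof. by rewrite heis_mean_ia sqrtr_gt0 mulr_gt0. Qed.

Lemma heis_mean_sqr k :
  heis_mean G (ia k) ^+ 2 = G (ia k) (ia k) * G (ib k) (ib k).
Proof. by rewrite heis_mean_ia sqr_sqrtr ?mulr_ge0 ?ltW // mulrC. Qed.

Lemma heis_kappa_gt0 : 0 < heis_kappa G.
Proof. by rewrite mulr_gt0 // prodr_gt0 // => k _; exact: heis_mean_gt0. Qed.

Lemma heis_rate_gt0 : 0 < heis_rate G.
Proof. by rewrite powR_gt0 // mulr_gt0 // heis_kappa_gt0. Qed.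

Lemma heis_gamma_gt0 i : 0 < heis_gamma G i.
Proof.
rewrite /heis_gamma; case: eqVneq => [_|iN].
  by rewrite mulr_gt0 ?heis_kappa_gt0 // powR_gt0 // mulr_gt0 // heis_kappa_gt0.
rewrite mulr_gt0 ?heis_rate_gt0 // divr_gt0 //.
move: (heis_indexP i) iN => [[k ->]|[k ->]|->]; rewrite ?eqxx // => _.
  exact: heis_mean_gt0.
by rewrite heis_mean_ib heis_mean_gt0.
Qed.

Lemma heis_gamma_ab k :
  heis_gamma G (ia k) * heis_gamma G (ib k) = heis_rate G ^+ 2.
Proof.
rewrite /heis_gamma ia_neqN ib_neqN heis_mean_ib.
have m0 : heis_mean G (ia k) != 0 by rewrite gt_eqF // heis_mean_gt0.
transitivity (heis_rate G ^+ 2 *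
  (G (ia k) (ia k) * G (ib k) (ib k) / heis_mean G (ia k) ^+ 2)); first by field.
rewrite heis_mean_sqr divff ?mulr1 // mulf_neq0 // gt_eqF //.
Qed.

Lemma heis_rate_pow : heis_rate G ^+ n.+2 = n.+2%:R * heis_kappa G.
Proof.
have A0 : 0 <= n.+2%:R * heis_kappa G.
  by rewrite mulr_ge0 // ltW // heis_kappa_gt0.
rewrite -powR_mulrn ?powR_ge0 // /heis_rate -powRrM.
by rewrite mul1r mulVf ?powRr1.
Qed.

Lemma heis_gamma_N : heis_gamma G N = heis_rate G ^+ 2 / n.+2%:R.
Proof.
have C0 : heis_rate G != 0 by rewrite gt_eqF // heis_rate_gt0.
rewrite /heis_gamma eqxx.
have -> : (n.+2%:R * heis_kappa G) `^ (- (n%:R / n.+2%:R)) = (heis_rate G ^+ n)^-1.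
  rewrite powRN -powR_mulrn ?powR_ge0 // /heis_rate -powRrM; congr (_ `^ _)^-1.
  by rewrite mul1r mulrC.
have -> : heis_kappa G = heis_rate G ^+ n.+2 / n.+2%:R.
  by rewrite heis_rate_pow mulrC mulKf.
have Cn : heis_rate G ^+ n != 0 by rewrite expf_neq0.
have n2 : n.+2%:R != 0 :> R by [].
rewrite !exprS; field; rewrite Cn andbT.
by move: n2; rewrite -[n.+2]add2n natrD.
Qed.

End PositiveDiagonal.

(** The quotient of two conjugate coefficients is constant, so both are constant
    multiples of their geometric mean [x k], and these means together with the
    coefficient of the centre satisfy the system studied above. *)
Section Flow.
Variable g : R -> M.
Hypothesis flow : ricci_flow `[0, +oo[ (fun t => left_invariant (g t)).
Hypothesis diag0 : is_diag_mx (g 0).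

Let ggt0 t i : 0 <= t -> 0 < g t i i.
Proof. by move=> t0; apply: inner_product_gt0; exact: flow_inner. Qed.

Let gneq0 t i : 0 <= t -> g t i i != 0.
Proof. by move=> t0; rewrite gt_eqF // ggt0. Qed.

Let g0gt0 i : 0 < g 0 i i. Proof. exact: ggt0. Qed.

Let s k := heis_mean (g 0) (ia k).

Let s0 k : s k != 0.
Proof. by rewrite gt_eqF // heis_mean_gt0. Qed.

Let x k t := s k / g 0 (ia k) (ia k) * g t (ia k) (ia k).

Let z t := g t N N.

Let ratio k t : 0 <= t -> g t (ia k) (ia k) =
  g 0 (ia k) (ia k) / g 0 (ib k) (ib k) * g t (ib k) (ib k).
Proof.
move=> t0; pose a u := z u / (g u (ia k) (ia k) * g u (ib k) (ib k)).
have Ea : evolves (fun u => g u (ia k) (ia k)) (fun u => a u * g u (ia k) (ia k)).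
  apply: evolves_eq (flow_evolves_ia flow diag0 k) => u /ltW u0.
  have := gneq0 (ia k) u0; have := gneq0 (ib k) u0 => ? ?.
  by rewrite /a /z; field; apply/andP.
have Eb : evolves (fun u => g u (ib k) (ib k)) (fun u => a u * g u (ib k) (ib k)).
  apply: evolves_eq (flow_evolves_ib flow diag0 k) => u /ltW u0.
  have := gneq0 (ia k) u0; have := gneq0 (ib k) u0 => ? ?.
  by rewrite /a /z; field; apply/andP.
exact: (evolves_proportional Ea Eb (fun u u0 => gneq0 (ib k) u0) t0).
Qed.

Let x_ib k t : 0 <= t -> x k t = s k / g 0 (ib k) (ib k) * g t (ib k) (ib k).
Proof.
move=> t0; rewrite /x (ratio k t0).
have := gneq0 (ia k) (lexx 0); have := gneq0 (ib k) (lexx 0) => ? ?.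
by field; apply/andP.
Qed.

Let x_gt0 k t : 0 <= t -> 0 < x k t.
Proof. by move=> t0; rewrite mulr_gt0 ?divr_gt0 ?ggt0 ?heis_mean_gt0. Qed.

Let x0E k : x k 0 = s k.
Proof. by rewrite /x divfK // gneq0. Qed.

Let x_sqr k t : 0 <= t -> x k t ^+ 2 = g t (ia k) (ia k) * g t (ib k) (ib k).
Proof.
move=> t0; rewrite expr2 {2}x_ib // /x.
have := heis_mean_sqr g0gt0 k; rewrite -/(s k) => sE.
have := gneq0 (ia k) (lexx 0); have := gneq0 (ib k) (lexx 0) => ? ?.
transitivity (s k ^+ 2 / (g 0 (ia k) (ia k) * g 0 (ib k) (ib k)) *
  (g t (ia k) (ia k) * g t (ib k) (ib k))); first by field; apply/andP.
by rewrite sE divff ?mul1r // mulf_neq0.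
Qed.

Let xE k : evolves (x k) (fun t => z t / x k t).
Proof.
apply: evolves_eq (evolvesZ _ (flow_evolves_ia flow diag0 k)) => t /ltW t0.
have xn : x k t != 0 by rewrite gt_eqF // x_gt0.
apply: (mulIf xn); rewrite divfK //.
have gb := gneq0 (ib k) t0; have ga := gneq0 (ia k) (lexx 0).
transitivity (z t * (x k t * (s k / g 0 (ia k) (ia k))) / g t (ib k) (ib k)).
  by rewrite /z; field; apply/andP.
have -> : s k / g 0 (ia k) (ia k) = x k t / g t (ia k) (ia k).
  by rewrite /x mulfK // gneq0.
have -> : x k t * (x k t / g t (ia k) (ia k)) = g t (ib k) (ib k).
  by rewrite mulrA -expr2 x_sqr // mulrC mulKf // gneq0.
by rewrite mulfK.
Qed.

Let zE : evolves z (fun t => - (z t ^+ 2 * \sum_(k < n) (x k t ^+ 2)^-1)).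
Proof.
apply: evolves_eq (flow_evolves_iN flow diag0) => t /ltW t0.
by congr (- (_ * _)); apply: eq_bigr => k _; rewrite x_sqr.
Qed.

Let z_gt0 t : 0 <= t -> 0 < z t. Proof. exact: ggt0. Qed.

Let kappaE : z 0 * \prod_(k < n) x k 0 = heis_kappa (g 0).
Proof. by congr (_ * _); apply: eq_bigr => k _; rewrite x0E. Qed.

Let asymp_x k (f : R -> R) c : 0 < c ->
  (forall t, 0 <= t -> f t = c * x k t) ->
  asymp_equiv f (fun t => (c * heis_rate (g 0)) * t `^ b).
Proof.
move=> c0 fE; rewrite /asymp_equiv.
have := diag_asymp n_gt0 x_gt0 z_gt0 xE zE k; rewrite kappaE -/(heis_rate _) => H.
have C0 : heis_rate (g 0) != 0 by rewrite gt_eqF // heis_rate_gt0.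
have H' : (heis_rate (g 0))^-1 * (x k t / t `^ b) @[t --> +oo] -->
    (heis_rate (g 0))^-1 * heis_rate (g 0).
  by apply: cvgM; [exact: cvg_cst|exact: H].
rewrite mulVf // in H'.
apply: cvg_trans H'; apply: near_eq_cvg; near=> t.
have t0 : 0 < t by near: t; exact: nbhs_pinfty_gt.
have tb : t `^ b != 0 by rewrite gt_eqF // powR_gt0.
have cn : c != 0 by rewrite gt_eqF.
by rewrite fE ?(ltW t0) //; field; rewrite cn C0 tb.
Unshelve. all: by end_near. Qed.

Lemma flow_asymp i : i != N -> asymp_equiv (fun t => g t i i)
  (fun t => heis_gamma (g 0) i * t `^ b).
Proof.
move=> neN; rewrite /heis_gamma (negbTE neN).
move: (heis_indexP i) neN => [[k ->]|[k ->]|->]; rewrite ?eqxx // => _.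
  apply: (@asymp_x k); first by rewrite divr_gt0 ?heis_mean_gt0.
  move=> t t0; rewrite -/(s k) /x.
  by have sk := s0 k; have ga := gneq0 (ia k) (lexx 0); field; apply/andP.
rewrite heis_mean_ib; apply: (@asymp_x k).
  by rewrite divr_gt0 ?heis_mean_gt0.
move=> t t0; rewrite -/(s k) x_ib //.
by have sk := s0 k; have ga := gneq0 (ib k) (lexx 0); field; apply/andP.
Qed.

Lemma flow_asympN : asymp_equiv (fun t => g t N N)
  (fun t => heis_gamma (g 0) N * t `^ (- (n%:R / n.+2%:R))).
Proof.
rewrite /asymp_equiv.
have := diag_asympN n_gt0 x_gt0 z_gt0 xE zE; rewrite kappaE => H.
have g0 := heis_gamma_gt0 g0gt0 N.
have gE : heis_gamma (g 0) N = heis_kappa (g 0) *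
  (n.+2%:R * heis_kappa (g 0)) `^ (- (n%:R / n.+2%:R)).
  by rewrite /heis_gamma eqxx.
rewrite -gE in H; have gn : heis_gamma (g 0) N != 0 by rewrite gt_eqF.
have H' : (heis_gamma (g 0) N)^-1 * (z t / t `^ (- (n%:R / n.+2%:R)))
    @[t --> +oo] --> (heis_gamma (g 0) N)^-1 * heis_gamma (g 0) N.
  by apply: cvgM; [exact: cvg_cst|exact: H].
rewrite mulVf // in H'.
apply: cvg_trans H'; apply: near_eq_cvg; near=> t.
have t0 : 0 < t by near: t; exact: nbhs_pinfty_gt.
have tb : t `^ (- (n%:R / n.+2%:R)) != 0 by rewrite gt_eqF // powR_gt0.
by rewrite /z; field; rewrite gn tb.
Unshelve. all: by end_near. Qed.

End Flow.
End FlowAsymptotics.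

(** * Dilations and the soliton *)

Section Dilations.
Variables (R : realType) (n : nat).
Local Notation M := 'M[R]_(n + n + 1).
Local Notation N := (iN n).
Local Notation U := (heis_pairing R n).
Local Notation eN := (eN R n).
Implicit Types (d : 'rV[R]_(n + n + 1)) (G : M).

Lemma diffeomorphism_lin (A : M) : A \in unitmx ->
  diffeomorphism (fun x : heis R n => x *m A).
Proof.
move=> Au; split; first by move=> j; exact: smooth_lin.
exists (fun x => x *m invmx A); split=> [j|x|x]; first exact: smooth_lin.
  exact: mulmxK.
exact: mulmxKV.
Qed.

Lemma diag_mx_unit d : (forall i, d 0 i != 0) -> diag_mx d \in unitmx.
Proof.
by move=> d0; rewrite unitmxE det_diag unitfE; apply/prodf_neq0 => i _.
Qed.

Definition heis_dilation d := forall k : 'I_n, d 0 (ia k) * d 0 (ib k) = d 0 N.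

Lemma heis_dilationU d : heis_dilation d ->
  diag_mx d *m U *m diag_mx d = d 0 N *: U.
Proof.
move=> dd; rewrite /heis_pairing mulmx_sumr mulmx_suml scaler_sumr.
apply: eq_bigr => k _; rewrite mul_mx_diag mul_diag_mx.
apply/matrixP => i j; rewrite !mxE -(dd k).
have [->|ik] := eqVneq i (ia k); last by rewrite /= mulr0 mul0r mulr0.
have [->|jk] := eqVneq j (ib k); last by rewrite /= mulr0 mul0r mulr0.
by rewrite !mulr1.
Qed.

(** Diagonal linear maps with [d_a d_b = d_N] are group automorphisms, and they
    rescale the left-invariant coframe. *)
Lemma pullback_dilation d G : heis_dilation d ->
  pullback (fun x : heis R n => x *m diag_mx d) (left_invariant G) =1
  left_invariant (diag_mx d *m G *m diag_mx d).
Proof.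
move=> dd x; rewrite /pullback jacobian_lin tr_diag_mx /left_invariant.
have E : coframe (x *m diag_mx d) *m diag_mx d = diag_mx d *m coframe x.
  rewrite !coframeE mulmxBl mulmxBr mul1mx mulmx1; congr (_ - _).
  rewrite -(mulmxA eN) -(mulmxA x) -(mulmxA x) heis_dilationU //.
  rewrite -!scalemxAr [diag_mx d *m (eN *m _)]mulmxA.
  have -> : diag_mx d *m eN = d 0 N *: eN.
    apply/colP => i; rewrite mul_diag_mx !mxE.
    by have [->|] := eqVneq i N; rewrite ?andbT //= !mulr0.
  by rewrite -scalemxAl.
rewrite !mulmxA -(mulmxA _ (coframe _)) E -!(mulmxA _ _ (diag_mx d)).
rewrite -{1}(tr_diag_mx d) -trmx_mul E trmx_mul tr_diag_mx.
by rewrite !mulmxA.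
Qed.

Lemma diag_conjE d G i j :
  (diag_mx d *m G *m diag_mx d) i j = d 0 i * d 0 j * G i j.
Proof. by rewrite mul_mx_diag mxE mul_diag_mx mxE; ring. Qed.

Lemma scale_left_invariant (a : R) G x :
  a *: left_invariant G x = left_invariant (a *: G) x.
Proof. by rewrite /left_invariant -scalemxAr -scalemxAl. Qed.

Lemma pullback_ext (f : heis R n -> heis R n) (g h : tensor_field R _) :
  g =1 h -> pullback f g =1 pullback f h.
Proof. by move=> gh x; rewrite /pullback gh. Qed.

End Dilations.

Section Soliton.
Variables (R : realType) (n : nat).
Local Notation M := 'M[R]_(n + n + 1).
Local Notation N := (iN n).
Local Notation U := (heis_pairing R n).
Local Notation Om := (heis_bracket R n).
Local Notation eN := (eN R n).
Local Notation Pi := (1%:M - eN *m eN^T : M).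

Lemma diag2E (a c : R) i j :
  diag2 n a c i j = (if i == N then c else a) *+ (i == j).
Proof.
rewrite /diag2.
case: (split_ordP i) => [i' ->|i' ->]; case: (split_ordP j) => [j' ->|j' ->].
- by rewrite block_mxEul mxE eq_lshift eq_lrshift.
- by rewrite block_mxEur mxE eq_lrshift.
- by rewrite block_mxEdl mxE eq_rlshift.
- by rewrite block_mxEdr mxE !ord1 !eqxx.
Qed.

Lemma diag2_Pi (a c : R) : diag2 n a c = a *: Pi + c *: (eN *m eN^T).
Proof.
apply/matrixP => i j; rewrite diag2E trmx_delta mul_delta_mx !mxE.
have [->|iN] := eqVneq i N; rewrite /=.
  by rewrite [N == j]eq_sym; have [_|_] := eqVneq j N => /=; ring.
by have [|] := eqVneq i j => _ /=; ring.
Qed.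

Lemma eNT_eN : eN^T *m eN = 1%:M.
Proof.
by rewrite trmx_delta mul_delta_mx; apply/matrixP => i j; rewrite !ord1 !mxE.
Qed.

Lemma heis_Pi_eN : Pi *m eN = 0.
Proof. by rewrite mulmxBl mul1mx -mulmxA eNT_eN mulmx1 subrr. Qed.

Lemma diag2_eN (a c : R) : diag2 n a c *m eN = c *: eN.
Proof.
rewrite diag2_Pi mulmxDl -!scalemxAl heis_Pi_eN scaler0 add0r.
by rewrite -mulmxA eNT_eN mulmx1.
Qed.

Lemma invmx_diag2 (a c : R) : a != 0 -> c != 0 ->
  invmx (diag2 n a c) = diag2 n a^-1 c^-1.
Proof.
move=> a0 c0.
have E : diag2 n a c *m diag2 n a^-1 c^-1 = 1%:M.
  rewrite [diag2 n a^-1 _]diag2_Pi mulmxDr -!scalemxAr mulmxBr mulmx1 mulmxA.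
  rewrite diag2_eN -scalemxAl [diag2 n a c]diag2_Pi addrK !scalerA.
  by rewrite mulVf // mulVf // !scale1r subrK.
have [Gu _] := mulmx1_unit E.
by rewrite -[RHS](mulKmx Gu) E mulmx1.
Qed.

Lemma heisO_conj_diag2 (a c : R) : Om *m diag2 n a c *m Om^T = a *: Pi.
Proof.
rewrite diag2_Pi mulmxDr mulmxDl -!(scalemxAr, scalemxAl).
rewrite [Om *m (eN *m _)]mulmxA heisO_eN !mul0mx scaler0 addr0.
by rewrite mulmxBr mulmx1 mulmxA heisO_eN mul0mx subr0 heisOOT.
Qed.

Lemma left_invariant_diag2 (a c : R) x : left_invariant (diag2 n a c) x =
  a *: Pi + c *: ((coframe x)^T *m eN *m ((coframe x)^T *m eN)^T).
Proof.
have PC : Pi *m coframe x = Pi.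
  by rewrite coframeE mulmxBr mulmx1 (mulmxA Pi) heis_Pi_eN mul0mx subr0.
have CP : (coframe x)^T *m Pi = Pi.
  have PT : Pi^T = Pi by rewrite linearB /= trmx1 trmx_mul trmxK.
  by rewrite -{1}PT -trmx_mul PC PT.
rewrite /left_invariant diag2_Pi (mulmxDr (coframe x)^T).
rewrite (mulmxDl _ _ (coframe x)) -!(scalemxAr, scalemxAl) CP PC.
by rewrite trmx_mul trmxK !mulmxA.
Qed.

Lemma diag2_inner (a c : R) : 0 < a -> 0 < c -> inner_product (diag2 n a c).
Proof.
move=> a0 c0; split.
  apply/matrixP => i j; rewrite mxE !diag2E [j == i]eq_sym.
  by have [->|] := eqVneq i j.
move=> v v0.
have E : (v *m diag2 n a c *m v^T) 0 0 =
    \sum_i (if i == N then c else a) * v 0 i ^+ 2.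
  rewrite mxE; apply: eq_bigr => i _; rewrite mxE (bigD1 i) //= big1 ?addr0.
    by rewrite diag2E eqxx mulr1n mxE mulrAC -expr2 mulrC.
  by move=> j ji; rewrite diag2E (negbTE ji) mulr0n mulr0.
rewrite E.
have ge0 i : 0 <= (if i == N then c else a) * v 0 i ^+ 2.
  by apply: mulr_ge0; rewrite ?sqr_ge0 //; case: ifP => _; exact: ltW.
rewrite lt_neqAle sumr_ge0 ?andbT //.
apply/negP => /eqP/esym/eqP; rewrite psumr_eq0 // => /allP H.
case/negP: v0; apply/eqP/rowP => i; rewrite mxE.
have := H i (mem_index_enum _); rewrite /= mulf_eq0 sqrf_eq0.
by case: (i == N); rewrite gt_eqF //= => /eqP.
Qed.

Lemma inner_product_congr (G A : M) : A \in unitmx -> inner_product G ->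
  inner_product (A^T *m G *m A).
Proof.
move=> Au [Gs Gp]; split; first by rewrite !trmx_mul trmxK Gs mulmxA.
move=> v v0; have := Gp (v *m A^T); rewrite trmx_mul trmxK !mulmxA; apply.
apply: contraNneq v0 => vA; have At : A^T \in unitmx by rewrite unitmx_tr.
by rewrite -(mulmxK At v) vA mul0mx.
Qed.

Lemma left_invariant_metric (G : M) : inner_product G ->
  riemannian_metric (left_invariant G).
Proof.
move=> Gi; split; last first.
  by move=> x; apply: inner_product_congr Gi; exact: coframe_unit.
move=> i j; under eq_fun do rewrite left_invariantE.
have su k : smooth (fun x : heis R n => (x *m U) 0 k) by exact: smooth_lin.
have sN f : smooth f -> smooth (fun x : heis R n => - f x).
  move=> sf; under eq_fun do rewrite -mulN1r.
  by apply: smoothM => //; exact: smooth_cst.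
have sc a : smooth (fun _ : heis R n => a) by exact: smooth_cst.
do !(apply: smoothD || apply: sN || apply: smoothM || exact: su || exact: sc).
Qed.

Lemma ricci_flow_eq m (I : set R) (g h : R -> tensor_field R m) :
  (forall t, I t -> g t = h t) -> ricci_flow I g -> ricci_flow I h.
Proof.
move=> gh gf t It; have [gm gl] := gf t It; rewrite -(gh t It); split=> //.
move=> x i j; apply: cvg_trans (gl x i j); apply: near_eq_cvg.
have H : \forall u \near within I t^', I u by exact: withinT.
by apply: filterS H => u Iu; rewrite gh.
Qed.

(** The two entries on the right are the right-hand sides of the ordinary
    differential equations for the two coefficients. *)
Lemma ricci_diag2 (a c : R) x : 0 < a -> 0 < c ->
  - 2 *: ricci (left_invariant (diag2 n a c)) x =
  left_invariant (diag2 n (c / a) (- (n%:R / a ^+ 2 * c ^+ 2))) x.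
Proof.
move=> a0 c0; have an : a != 0 by rewrite gt_eqF.
have Gi := diag2_inner a0 c0.
have [Gs _] := Gi; have Gu := inner_product_unit Gi.
rewrite (ricci_left_invariant Gs Gu) mxtrace_heisO_diag //; last first.
  by apply/is_diag_mxP => k l; rewrite val_eqE diag2E => /negbTE ->.
rewrite invmx_diag2 ?gt_eqF // heisO_conj_diag2 /heis_mu diag2_eN.
rewrite left_invariant_diag2 -scalemxAr.
move: ((coframe x)^T *m eN) => w.
under eq_bigr => k _ do rewrite !diag2E !eqxx ia_neqN ib_neqN.
rewrite sumr_const card_ord diag2E !eqxx /= [(c *: w)^T]linearZ /=.
rewrite -!(scalemxAr, scalemxAl).
rewrite scalerBr !scalerA -scaleNr; congr (_ *: _ + _ *: _); first by field.
by rewrite -[_ *+ n]mulr_natr; field.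
Qed.

Lemma ginf_flow_ricci_flow :
  ricci_flow `]0, +oo[
    (fun t => left_invariant (ginf_flow n t) : tensor_field R _).
Proof.
move=> t /=; rewrite in_itv /= andbT => t0.
set p := t `^ (1 / n.+2%:R); set c := n.+2%:R^-1 * t `^ (- (n%:R / n.+2%:R)).
have p0 : 0 < p by rewrite powR_gt0.
have c0 : 0 < c by rewrite mulr_gt0 ?invr_gt0 // powR_gt0.
split; first exact/left_invariant_metric/diag2_inner.
move=> x i j; apply: is_derive_quotient.
pose G' : M := diag2 n (c / p) (- (n%:R / p ^+ 2 * c ^+ 2)).
have -> : - 2 * ricci (left_invariant (ginf_flow n t)) x i j =
    left_invariant G' x i j.
  by rewrite -(ricci_diag2 x p0 c0) [RHS]mxE.
have n20 : n.+2%:R != 0 :> R by [].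
have pD e f : t `^ (e + f) = t `^ e * t `^ f.
  by rewrite powRD //; apply/implyP => _; rewrite gt_eqF.
have pn : p != 0 by rewrite gt_eqF.
have De a b : is_derive t 1 (fun u => ginf_flow n u a b) (G' a b).
  under eq_fun do rewrite diag2E; rewrite diag2E.
  have dp e : is_derive t 1 (fun u => u `^ e) (e * t `^ (e - 1)).
    exact: is_derive1_powR.
  have [ab|ab] := eqVneq a b; last by apply: is_derive_fcst.
  have [aN|aN] := eqVneq a N; rewrite /=; under eq_fun do rewrite mulr1n.
    apply: (is_derive_eq (is_derive_fM (is_derive_fcst _ _ _) (dp _))).
    rewrite mul0r add0r mulr1n /c.
    suff E : t `^ (- (n%:R / n.+2%:R)) * t `^ (- (n%:R / n.+2%:R)) =
        t `^ (- (n%:R / n.+2%:R) - 1) * p * p.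
      move: E; set y := t `^ _; set w := t `^ _ => E.
      have -> : (n.+2%:R^-1 * y) ^+ 2 = n.+2%:R^-1 ^+ 2 * (y * y) by ring.
      rewrite E; move: (n.+2%:R) n20 => m m0.
      by field; rewrite m0 pn.
    rewrite -!pD; congr (_ `^ _).
    by move: n20; rewrite -[n.+2]add2n natrD => n20; field.
  apply: (is_derive_eq (dp _)); rewrite mulr1n /c.
  have -> : t `^ (- (n%:R / n.+2%:R)) = t `^ (1 / n.+2%:R - 1) * p.
    rewrite -pD; congr (_ `^ _).
    by move: n20; rewrite -[n.+2]add2n natrD => n20; field.
  by rewrite mulrA mulfK // mul1r.
under eq_fun do rewrite left_invariantE.
apply: (is_derive_eq (is_derive_fD
  (is_derive_fB
    (is_derive_fB (De i j) (is_derive_fM (is_derive_fcst _ _ _) (De N j)))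
    (is_derive_fM (De i N) (is_derive_fcst _ _ _)))
  (is_derive_fM (De N N) (is_derive_fcst _ _ _)))).
by rewrite left_invariantE /=; ring.
Qed.

End Soliton.

(** * Convergence of the blowdowns *)

Section Blowdown.
Variables (R : realType) (n : nat).
Local Notation M := 'M[R]_(n + n + 1).
Local Notation N := (iN n).
Local Notation b := (1 / n.+2%:R : R).
Local Notation e := (n.+1%:R / n.+2%:R : R).

Definition eta_row t : 'rV[R]_(n + n + 1) :=
  \row_i if i == N then t `^ (- e) else t `^ (- (2^-1 * e)).

Lemma etaE t : @eta R n t = fun x => x *m diag_mx (eta_row t).
Proof.
apply/funext => x; apply/rowP => j; rewrite mul_mx_diag.
rewrite [RHS]mxE [X in _ = _ * X]mxE /eta.
case: (split_ordP j) => j' ->.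
  by rewrite row_mxEl !mxE eq_lrshift mulrC.
by rewrite row_mxEr !mxE !ord1 eqxx mulrC.
Qed.

Lemma powRDt (t x y : R) : 0 < t -> t `^ (x + y) = t `^ x * t `^ y.
Proof.
by move=> t0; rewrite powRD //; apply/implyP => _; rewrite gt_eqF.
Qed.

Lemma eta_dilation t : 0 < t -> heis_dilation (eta_row t).
Proof.
move=> t0 k; rewrite !mxE ia_neqN ib_neqN eqxx -powRDt //; congr (_ `^ _).
by field.
Qed.

Lemma eta_diffeomorphism t : 0 < t -> diffeomorphism (@eta R n t).
Proof.
move=> t0; rewrite etaE; apply/diffeomorphism_lin/diag_mx_unit => i.
by rewrite mxE; case: ifP => _; rewrite gt_eqF // powR_gt0.
Qed.

Let n2 : 2 + n%:R != 0 :> R.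
Proof. by rewrite -natrD add2n. Qed.

Let n2E : n.+2%:R = 2 + n%:R :> R.
Proof. by rewrite -natrD add2n. Qed.

Let n1E : n.+1%:R = 1 + n%:R :> R.
Proof. by rewrite nat1r. Qed.

Lemma eta_pullback t x : 0 < t ->
  t *: pullback (eta t) (left_invariant (ginf R n)) x =
  left_invariant (ginf_flow n t) x.
Proof.
move=> t0; rewrite etaE (pullback_dilation _ (eta_dilation t0)).
rewrite scale_left_invariant.
congr (left_invariant _ x); apply/matrixP => i j.
rewrite mxE diag_conjE !diag2E !mxE.
have [<-|_] := eqVneq i j; last by rewrite !mulr0n !mulr0.
rewrite !mulr1n; have t1 : t = t `^ 1 by rewrite powRr1 // ltW.
case: ifP => _.
  rewrite mulrA mulrC; congr (_ * _); rewrite {1}t1 -!powRDt //; congr (_ `^ _).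
  by rewrite n1E n2E; field.
rewrite mulr1 {1}t1 -!powRDt //; congr (_ `^ _).
by rewrite n1E n2E; field.
Qed.

Lemma ginf_flow1 : ginf_flow n 1 = ginf R n.
Proof. by rewrite /ginf_flow !powR1 mulr1. Qed.

Lemma eta_soliton : expanding_nilsoliton (@eta R n) (ginf R n).
Proof.
split; first exact: eta_diffeomorphism.
apply: ricci_flow_eq (@ginf_flow_ricci_flow R n) => t /=.
rewrite in_itv /= andbT => t0; apply/funext => x.
by rewrite -eta_pullback.
Qed.

Section Flow.
Hypothesis n_gt0 : (0 < n)%N.
Variable g : R -> M.
Hypothesis flow : ricci_flow `[0, +oo[ (fun t => left_invariant (g t)).
Hypothesis diag0 : is_diag_mx (g 0).

Let g0gt0 i : 0 < g 0 i i.
Proof. by apply: inner_product_gt0; exact: flow_inner. Qed.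

Let C := heis_rate (g 0).
Let gam := heis_gamma (g 0).

Let C0 : C != 0. Proof. by rewrite gt_eqF // heis_rate_gt0. Qed.

Let gam_gt0 i : 0 < gam i. Proof. exact: heis_gamma_gt0. Qed.

(** The square roots equalize the leading coefficients of all the directions; their
    products over conjugate pairs agree by [heis_gamma_ab], which makes these
    diagonal maps group automorphisms. *)
Definition blowdown_row s : 'rV[R]_(n + n + 1) :=
  \row_i if i == N then s `^ e / C else s `^ (2^-1 * e) / Num.sqrt (gam i).

Lemma blowdown_row_dilation s : 0 < s -> heis_dilation (blowdown_row s).
Proof.
move=> s0 k; rewrite !mxE ia_neqN ib_neqN eqxx.
have E : Num.sqrt (gam (ia k)) * Num.sqrt (gam (ib k)) = C.
  rewrite -sqrtrM ?(ltW (gam_gt0 _)) // heis_gamma_ab // sqrtr_sqr ger0_norm //.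
  by rewrite ltW // heis_rate_gt0.
rewrite -E invfM mulrACA -powRDt //; congr (_ `^ _ * _).
by field.
Qed.

Lemma blowdown_diffeomorphism s : 0 < s ->
  diffeomorphism (fun x : heis R n => x *m diag_mx (blowdown_row s)).
Proof.
move=> s0; apply/diffeomorphism_lin/diag_mx_unit => i; rewrite mxE.
have sp a : s `^ a != 0 by rewrite gt_eqF // powR_gt0.
by case: ifP => _; rewrite mulf_neq0 // invr_eq0 // gt_eqF // sqrtr_gt0.
Qed.

(** The leading term of the asymptotics becomes the soliton exactly, for every [s],
    so the limit only involves the relative error of that term. *)
Lemma blowdown_leading s t i : 0 < s -> 0 < t ->
  blowdown_row s 0 i ^+ 2 * (s^-1 * (gam i *
    (if i == N then (s * t) `^ (- (n%:R / n.+2%:R)) else (s * t) `^ b))) =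
  ginf_flow n t i i.
Proof.
move=> s0 t0; rewrite diag2E eqxx mulr1n mxE.
have [s0' t0'] := (ltW s0, ltW t0).
have s1 : s^-1 = s `^ (-1) by rewrite powR_inv1.
case: (eqVneq i N) => [->|_]; rewrite powRM //.
  rewrite /gam heis_gamma_N // -/C s1.
  have E : s `^ e * s `^ e * s `^ (-1) * s `^ (- (n%:R / n.+2%:R)) = 1.
    rewrite -!powRDt //; transitivity (s `^ 0); last exact: powRr0.
    congr (_ `^ _).
    by rewrite n1E n2E; field.
  transitivity (n.+2%:R^-1 * t `^ (- (n%:R / n.+2%:R)) *
    (s `^ e * s `^ e * s `^ (-1) * s `^ (- (n%:R / n.+2%:R)))).
    by move: (s `^ _) (t `^ _) => y w; rewrite n2E; field; rewrite n2 C0.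
  by rewrite E mulr1.
rewrite expr_div_n sqr_sqrtr ?(ltW (gam_gt0 i)) // s1.
have gi : gam i != 0 by rewrite gt_eqF.
have E : s `^ (2^-1 * e) * s `^ (2^-1 * e) * s `^ (-1) * s `^ b = 1.
  rewrite -!powRDt //; transitivity (s `^ 0); last exact: powRr0.
  congr (_ `^ _).
  by rewrite n1E n2E; field.
transitivity (t `^ b * (s `^ (2^-1 * e) * s `^ (2^-1 * e) * s `^ (-1) * s `^ b)).
  by move: (s `^ _) (t `^ _) => y w; field.
by rewrite E mulr1.
Qed.

Lemma blowdown_cvg t : 0 < t ->
  left_invariant_cvg
    (fun s => pullback (fun x => x *m diag_mx (blowdown_row s))
      (blowdown (fun u => left_invariant (g u)) s t))
    (ginf_flow n t).
Proof.
move=> t0.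
exists (fun s => diag_mx (blowdown_row s) *m (s^-1 *: g (s * t)) *m
  diag_mx (blowdown_row s)); split.
  move=> s s0 x; rewrite -(pullback_dilation _ (blowdown_row_dilation s0)).
  by apply: pullback_ext => y; rewrite /blowdown scale_left_invariant.
move=> i j; have [<-|ij] := eqVneq i j; last first.
  rewrite diag2E (negbTE ij) mulr0n; apply: cvg_near_cst; near=> s.
  have st : 0 <= s * t.
    by rewrite mulr_ge0 // ltW //; near: s; exact: nbhs_pinfty_gt.
  have /is_diag_mxP d := flow_diag flow diag0 st.
  have gij : g (s * t) i j = 0 by rewrite d // val_eqE.
  by rewrite diag_conjE [X in _ * X]mxE gij !mulr0.
pose p u := if i == N then u `^ (- (n%:R / n.+2%:R)) else u `^ b.
have A : asymp_equiv (fun u => g u i i) (fun u => gam i * p u).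
  rewrite /p; case: (eqVneq i N) => [->|iN]; first exact: flow_asympN.
  exact: flow_asymp.
have A' : g (s * t) i i / (gam i * p (s * t)) @[s --> +oo] --> (1 : R).
  have st : s * t @[s --> +oo] --> +oo by apply: gt0_cvgMly => //; exact: cvg_id.
  exact: (cvg_comp _ _ st A).
have H : g (s * t) i i / (gam i * p (s * t)) * ginf_flow n t i i
    @[s --> +oo] --> 1 * ginf_flow n t i i.
  by apply: cvgM => //; exact: cvg_cst.
rewrite mul1r in H; apply: cvg_trans H; apply: near_eq_cvg; near=> s.
have s0 : 0 < s by near: s; exact: nbhs_pinfty_gt.
rewrite diag_conjE -(blowdown_leading i s0 t0) [X in _ = _ * X]mxE -/(p (s * t)).
have ps : p (s * t) != 0.
  by rewrite gt_eqF // /p; case: ifP => _; rewrite powR_gt0 // mulr_gt0.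
have gi : gam i != 0 by rewrite gt_eqF.
have sn : s != 0 by rewrite gt_eqF.
by rewrite -expr2; field; rewrite ps gi sn.
Unshelve. all: by end_near. Qed.

End Flow.
End Blowdown.

Theorem theorem1p1 (R : realType) (n : nat) (hn : (1 <= n)%N)
    (g0 : 'M[R]_(n + n + 1)) (hg0 : inner_product g0)
    (hdiag : is_diag_mx g0) :
  (exists gamma : 'I_(n + n + 1) -> R,
    forall g : R -> 'M[R]_(n + n + 1),
      g 0 = g0 ->
      ricci_flow `[0, +oo[ (fun t => left_invariant (g t)) ->
      [/\ forall t, 0 <= t -> is_diag_mx (g t),
          forall i : 'I_(n + n),
            asymp_equiv (fun t => g t (lshift 1 i) (lshift 1 i))
              (fun t => gamma (lshift 1 i) * t `^ (1 / n.+2%:R)),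
          asymp_equiv (fun t => g t (iN n) (iN n))
            (fun t => gamma (iN n) * t `^ (- (n%:R / n.+2%:R)))
        & exists phi : R -> heis R n -> heis R n,
            (forall s, 0 < s -> diffeomorphism (phi s)) /\
            forall t, 0 < t ->
              left_invariant_cvg
                (fun s => pullback (phi s)
                   (blowdown (fun u => left_invariant (g u)) s t))
                (ginf_flow n t)]) /\
  [/\ ginf_flow n 1 = ginf R n,
      expanding_nilsoliton (@eta R n) (ginf R n)
    & forall t, 0 < t ->
        left_invariant (ginf_flow n t)
          =1 (fun x => t *: pullback (eta t) (left_invariant (ginf R n)) x)].
Proof.
split; last by split; [exact: ginf_flow1|exact: eta_soliton|
  move=> t t0 x; rewrite eta_pullback].
exists (heis_gamma g0) => g g00 flow; rewrite -g00 in hdiag *.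
split.
- exact: flow_diag.
- by move=> i; apply: flow_asymp => //; rewrite eq_lrshift.
- exact: flow_asympN.
exists (fun s x => x *m diag_mx (blowdown_row g s)); split.
  by move=> s s0; exact: blowdown_diffeomorphism.
by move=> t t0; exact: blowdown_cvg.
Qed.
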